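(* Let $t_0<t_1$, $0<\alpha\le 1$, $\beta>0$, $x_0,x_1\in\mathbb{R}^n$, and let $L=L(t,x,y)$ be a real function of $2n+1$ variables ($t\in\mathbb{R}$, $x,y\in\mathbb{R}^n$). Consider the problem ($P_2$): extremize $$J(x(\cdot))=\int_{t_0}^{t_1}(t_1-t)^{\beta-1}L\big(t,x(t),({}^{c}D^{\alpha}_{t_0+}x)(t)\big)\,dt,\qquad x(t_0)=x_0,\quad x(t_1)=x_1,$$ over $x\in PC^{\alpha}([t_0,t_1],\mathbb{R}^n)$. Let $x^0\in PC^{\alpha}([t_0,t_1],\mathbb{R}^n)$ be admissible, let $T$ be the set of continuity points of ${}^{c}D^{\alpha}_{t_0+}x^0$ in $[t_0,t_1]$, and suppose that $L,L_x$ are continuous in some neighborhood of the graph $\{(t,x^0(t),({}^{c}D^{\alpha}_{t_0+}x^0)(t)):t\in[t_0,t_1]\}$. For $\tau\in T$, $a,b>0$, $\xi\in\mathbb{R}^n$ consider the inequality $$aL\big(\tau,x^0(\tau),({}^{c}D^{\alpha}_{t_0+}x^0)(\tau)+\xi\big)+bL\big(\tau,x^0(\tau),({}^{c}D^{\alpha}_{t_0+}x^0)(\tau)-\tfrac{a}{b}\xi\big)-(a+b)L\big(\tau,x^0(\tau),({}^{c}D^{\alpha}_{t_0+}x^0)(\tau)\big)\ge 0.\qquad( * )$$ (i) (Strong minimum) If $x^0$ provides a strong local minimum in ($P_2$), then $( * )$ holds for all $\tau\in T$, all $a,b>0$ and all $\xi\in\mathbb{R}^n$. (ii) (Weak minimum)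 If $x^0$ provides a weak local minimum in ($P_2$), then there exists $\delta>0$ such that $( * )$ holds for all $\tau\in T$, all $a,b>0$ with $\frac{a}{b}<1$, and all $\xi\in\mathbb{R}^n$ with $\|\xi\|\le\frac{\delta}{2}$.
   Context: $PC([t_0,t_1],\mathbb{R}^n)$ is the set of piecewise continuous functions: continuous on $[t_0,t_1]$ except at finitely many points of $(t_0,t_1)$, where they have discontinuities of the first kind (finite one-sided limits). For $\alpha>0$: $(I^{\alpha}_{t_0+}\varphi)(t)=\frac{1}{\Gamma(\alpha)}\int_{t_0}^{t}(t-\tau)^{\alpha-1}\varphi(\tau)\,d\tau$. For $0<\alpha<1$ and continuous $\varphi$: $({}^{c}D^{\alpha}_{t_0+}\varphi)(t)=\frac{d}{dt}\big(I^{1-\alpha}_{t_0+}(\varphi(\cdot)-\varphi(t_0))\big)(t)$; for $\alpha=1$ it is the ordinary derivative. $PC^{\alpha}([t_0,t_1],\mathbb{R}^n)$ is the set of all continuous $\varphi$ with $\varphi(t)=\varphi(t_0)+(I^{\alpha}_{t_0+}\psi)(t)$ on $[t_0,t_1]$ for some $\psi\in PC([t_0,t_1],\mathbb{R}^n)$; then ${}^{c}D^{\alpha}_{t_0+}\varphi=\psi$ at the continuity points of $\psi$. Norm: $\|y\|_{PC^{\alpha}}=\|y\|_{C}+\|{}^{c}D^{\alpha}_{t_0+}y\|_{L^{\infty}}$. A function $x\in PC^{\alpha}([t_0,t_1],\mathbb{R}^n)$ is admissible if $x(t_0)=x_0$, $x(t_1)=x_1$. An admissible $x^0$ provides a strong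 (respectively weak) local minimum if there is $\delta>0$ such that $J(x(\cdot))\ge J(x^0(\cdot))$ for every admissible $x$ with $\|x-x^0\|_{C}<\delta$ (respectively $\|x-x^0\|_{PC^{\alpha}}<\delta$). $L_x$ denotes the gradient in $x$.
   Formalization: In (i), L is also assumed continuous near {(t,x^0(t),y): t in [t_0,t_1], y in R^n}, as (i) fails if L is arbitrary far from the graph; where the derivative of x^0 jumps, the graph (undefined there) is read as containing the points given by its one-sided limits. *)

(* Defs.v *)
From HB Require Import structures.
From mathcomp Require Import all_boot all_order all_algebra.
From mathcomp Require Import all_classical all_reals all_analysis.
From mathcomp Require Import ess_sup_inf.

Set Implicit Arguments.
Unset Strict Implicit.
Unset Printing Implicit Defensive.

Import Order.TTheory GRing.Theory Num.Theory.
Import numFieldNormedType.Exports.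

Local Open Scope classical_set_scope.
Local Open Scope ring_scope.

(* Functions on [t0, t1] are represented by total functions on R; every
   definition below depends only on their values on [t0, t1].  R^n (n >= 1)
   is 'rV[R]_n.+1 with the norm of the library, which is the max norm. *)

Definition Gamma (R : realType) (a : R) : R :=
  \int[lebesgue_measure]_(t in `]0, +oo[) (t `^ (a - 1) * expR (- t)).

Definition frac_int (R : realType) (n : nat) (a t0 : R)
    (phi : R -> 'rV[R]_n.+1) (t : R) : 'rV[R]_n.+1 :=
  \row_i ((Gamma a)^-1 *
    \int[lebesgue_measure]_(s in `[t0, t]) ((t - s) `^ (a - 1) * phi s 0 i)).

(* Derivative of a function defined on [t0, t1] only, hence one-sided at t0
   and at t1.  The value is unspecified where the limit does not exist. *)
Definition derive_on (R : realType) (n : nat) (t0 t1 : R)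
    (g : R -> 'rV[R]_n.+1) (t : R) : 'rV[R]_n.+1 :=
  lim ((fun s => (s - t)^-1 *: (g s - g t)) @ within `[t0, t1]%classic t^').

Definition caputo (R : realType) (n : nat) (a t0 t1 : R)
    (phi : R -> 'rV[R]_n.+1) : R -> 'rV[R]_n.+1 :=
  derive_on t0 t1
    (if a == 1 then phi
     else frac_int (1 - a) t0 (fun s => phi s - phi t0)).

Definition continuous_on_at (R : realType) (n : nat) (t0 t1 : R)
    (f : R -> 'rV[R]_n.+1) (t : R) : Prop :=
  f s @[s --> within `[t0, t1]%classic (nbhs t)] --> f t.

Definition PC (R : realType) (n : nat) (t0 t1 : R) (psi : R -> 'rV[R]_n.+1)
    : Prop :=
  exists D : set R,
    [/\ finite_set D, D `<=` `]t0, t1[%classic,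
        forall t, t \in `[t0, t1] -> ~ D t -> continuous_on_at t0 t1 psi t
      & forall t, D t -> cvg (psi @ t^'-) /\ cvg (psi @ t^'+)].

Definition PCa (R : realType) (n : nat) (a t0 t1 : R) (phi : R -> 'rV[R]_n.+1)
    : Prop :=
  {within `[t0, t1]%classic, continuous phi} /\
  exists2 psi, PC t0 t1 psi &
    forall t, t \in `[t0, t1] -> phi t = phi t0 + frac_int a t0 psi t.

Definition norm_C (R : realType) (n : nat) (t0 t1 : R) (y : R -> 'rV[R]_n.+1)
    : \bar R :=
  ereal_sup [set `|y t|%:E | t in `[t0, t1]%classic].

Definition norm_Linf (R : realType) (n : nat) (t0 t1 : R)
    (y : R -> 'rV[R]_n.+1) : \bar R :=
  ess_sup lebesgue_measure ((fun t => `|y t|%:E) \_ `[t0, t1]%classic).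

Definition norm_PCa (R : realType) (n : nat) (a t0 t1 : R)
    (y : R -> 'rV[R]_n.+1) : \bar R :=
  (norm_C t0 t1 y + norm_Linf t0 t1 (caputo a t0 t1 y))%E.

Definition integrand (R : realType) (n : nat) (a b t0 t1 : R)
    (L : R -> 'rV[R]_n.+1 -> 'rV[R]_n.+1 -> R) (x : R -> 'rV[R]_n.+1) (t : R)
    : R :=
  (t1 - t) `^ (b - 1) * L t (x t) (caputo a t0 t1 x t).

Definition J (R : realType) (n : nat) (a b t0 t1 : R)
    (L : R -> 'rV[R]_n.+1 -> 'rV[R]_n.+1 -> R) (x : R -> 'rV[R]_n.+1) : R :=
  \int[lebesgue_measure]_(t in `[t0, t1]) integrand a b t0 t1 L x t.

(* [J] is a total function in Rocq; this delimits where it is meaningful. *)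
Definition J_defined (R : realType) (n : nat) (a b t0 t1 : R)
    (L : R -> 'rV[R]_n.+1 -> 'rV[R]_n.+1 -> R) (x : R -> 'rV[R]_n.+1) : Prop :=
  lebesgue_measure.-integrable `[t0, t1]
    (EFin \o integrand a b t0 t1 L x).

Definition admissible (R : realType) (n : nat) (a t0 t1 : R)
    (x0 x1 : 'rV[R]_n.+1) (x : R -> 'rV[R]_n.+1) : Prop :=
  [/\ PCa a t0 t1 x, x t0 = x0 & x t1 = x1].

Definition strong_local_min (R : realType) (n : nat) (a b t0 t1 : R)
    (L : R -> 'rV[R]_n.+1 -> 'rV[R]_n.+1 -> R) (x0 x1 : 'rV[R]_n.+1)
    (xo : R -> 'rV[R]_n.+1) : Prop :=
  admissible a t0 t1 x0 x1 xo /\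
  exists2 d : R, 0 < d &
    forall x, admissible a t0 t1 x0 x1 x -> J_defined a b t0 t1 L x ->
      (norm_C t0 t1 (x \- xo)%R < d%:E)%E ->
      J a b t0 t1 L xo <= J a b t0 t1 L x.

Definition weak_local_min (R : realType) (n : nat) (a b t0 t1 : R)
    (L : R -> 'rV[R]_n.+1 -> 'rV[R]_n.+1 -> R) (x0 x1 : 'rV[R]_n.+1)
    (xo : R -> 'rV[R]_n.+1) : Prop :=
  admissible a t0 t1 x0 x1 xo /\
  exists2 d : R, 0 < d &
    forall x, admissible a t0 t1 x0 x1 x -> J_defined a b t0 t1 L x ->
      (norm_PCa a t0 t1 (x \- xo)%R < d%:E)%E ->
      J a b t0 t1 L xo <= J a b t0 t1 L x.

(* At a jump of the derivative the limit in [derive_on] does not exist; the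
   unspecified value there cannot make [caputo] continuous. *)
Definition cont_points (R : realType) (n : nat) (a t0 t1 : R)
    (x : R -> 'rV[R]_n.+1) : set R :=
  [set t | t \in `[t0, t1] /\ continuous_on_at t0 t1 (caputo a t0 t1 x) t].

Definition grad_x (R : realType) (n : nat)
    (L : R -> 'rV[R]_n.+1 -> 'rV[R]_n.+1 -> R) (t : R)
    (x y : 'rV[R]_n.+1) : 'rV[R]_n.+1 :=
  \row_i 'D_(delta_mx 0 i) (fun z => L t z y) x.

(* The graph over the points where the derivative is continuous. Its closure,
   used in the next two definitions, adds at each jump of the derivative the
   two points given by its one-sided limits. *)
Definition graph (R : realType) (n : nat) (a t0 t1 : R)
    (x : R -> 'rV[R]_n.+1) : set (R * 'rV[R]_n.+1 * 'rV[R]_n.+1) :=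
  [set (t, x t, caputo a t0 t1 x t) | t in cont_points a t0 t1 x].

Definition L_continuous_near (R : realType) (n : nat)
    (L : R -> 'rV[R]_n.+1 -> 'rV[R]_n.+1 -> R)
    (A : set (R * 'rV[R]_n.+1 * 'rV[R]_n.+1)) : Prop :=
  exists U : set (R * 'rV[R]_n.+1 * 'rV[R]_n.+1),
    [/\ open U, closure A `<=` U
      & forall p, U p -> {for p, continuous (fun q => L q.1.1 q.1.2 q.2)}].

Definition L_Lx_continuous_near (R : realType) (n : nat)
    (L : R -> 'rV[R]_n.+1 -> 'rV[R]_n.+1 -> R)
    (A : set (R * 'rV[R]_n.+1 * 'rV[R]_n.+1)) : Prop :=
  exists U : set (R * 'rV[R]_n.+1 * 'rV[R]_n.+1),
    [/\ open U, closure A `<=` U,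
        forall p, U p -> {for p, continuous (fun q => L q.1.1 q.1.2 q.2)},
        forall p, U p -> differentiable (fun z => L p.1.1 z p.2) p.1.2
      & forall p, U p ->
          {for p, continuous (fun q => grad_x L q.1.1 q.1.2 q.2)}].

(* All (t, x(t), y) with y arbitrary.  The inequality for a strong minimum, with
   xi unrestricted, evaluates L at such points, possibly far from [graph]. *)
Definition cylinder (R : realType) (n : nat) (t0 t1 : R)
    (x : R -> 'rV[R]_n.+1) : set (R * 'rV[R]_n.+1 * 'rV[R]_n.+1) :=
  [set p | p.1.1 \in `[t0, t1] /\ p.1.2 = x p.1.1].

(* Main.v *)
(** Suppose the inequality fails at tau; by continuity tau may be taken in the open interval.  Let
the pulse be xi on [tau, tau1), - k xi on [tau1, tau2) and 0 elsewhere, where tau1 = tau + a h,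
tau2 = tau1 + b h and k is chosen so that the fractional integral of the pulse of order alpha
vanishes at t1.  As the kernel (t1 - s) ^ (alpha - 1) is monotone, k <= a / b, and k tends to a / b
with h.  Adding this fractional integral to xo gives an admissible x, uniformly close to xo.  On the
pulse, J changes by h (t1 - tau) ^ (beta - 1) (a L1 + b L2 - (a + b) L0) + o(h), which is negative of
order h.

The fractional integral has memory: x differs from xo up to t1, and the change of J on [tau2, t1] is
at most a constant times the integral of (t1 - t) ^ (beta - 1) |x - xo|, since L is Lipschitz in x
uniformly along the graph.  By the choice of k, |x - xo| is at most a constant times
h ((1 + o(1)) (t - tau2) ^ (alpha - 1) - (t - tau) ^ (alpha - 1)) there.  Both terms integrate against
the weight to Beta integrals whose difference tends to 0, so the tail is o(h) as well. *)
Require Import Defs.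
From HB Require Import structures.
From mathcomp Require Import all_boot all_order all_algebra.
From mathcomp Require Import all_classical all_reals all_analysis.
From mathcomp Require Import measurable_realfun ess_sup_inf ring lra.
Import Order.TTheory GRing.Theory Num.Theory.
Import numFieldNormedType.Exports.
Set Implicit Arguments.
Unset Strict Implicit.
Unset Printing Implicit Defensive.
Local Open Scope classical_set_scope.
Local Open Scope ring_scope.

(** The Caputo derivative of the variation is the pulse times xi, whose size does not decrease with
    h; only the uniform distance to [xo] does. Hence a strong minimum is contradicted whatever xi
    is, while against a weak minimum max(1, a/b)|xi| has to fit into the given radius: this is where
    a/b < 1 and the bound on xi enter.

    For alpha < 1 the memory kernel is singular at tau2, and for beta < 1 the weight is singular at
    t1. Near tau2 the quotient |x - xo| / h is not even bounded as h tends to 0, so no pointwise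
    estimate gives o(h); only the weighted integral is small. This is why complete Beta integrals
    started at tau and at tau2 are compared.

    [caputo] is a limit with unspecified values at finitely many points, so the pointwise estimates
    hold outside finite sets, which integrals and essential suprema ignore. Minimality speaks only
    of competitors with a defined functional, so integrability of the perturbed integrand is part of
    the construction. *)

Section beta_kernel.
Context {R : realType}.
Notation mu := (@lebesgue_measure R).

(** * Affine changes of variable; Beta and Gamma integrals *)

Lemma measurable_affine (l m : R) : measurable_fun setT (fun x : R => l * x + m).
Proof. by apply: measurable_funD => //; exact: measurable_funM. Qed.

(** Uniqueness of Lebesgue measure: the scaled pushforward gives every half-open interval its
    length. *)
Lemma lebesgue_measure_affine (l m : R) (A : set R) : 0 < l -> measurable A ->
  mu A = (l%:E * mu ((fun x : R => l * x + m)%R @^-1` A))%E.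
Proof.
move=> l0 mA; pose k : {nonneg R} := NngNum (ltW l0).
pose F : measurableTypeR R -> measurableTypeR R := fun x => l * x + m.
have mF : measurable_fun setT F by exact: measurable_affine.
pose mF_ := isMeasurableFun.Build _ _ _ _ _ mF.
pose F_ : {mfun measurableTypeR R >-> measurableTypeR R} := HB.pack F mF_.
rewrite (@lebesgue_measure_unique R (mscale k (pushforward mu F_))) //=.
move=> _ [[a b]] _ <-; rewrite /mscale /pushforward /=.
have -> : pushforward mu F `]a, b]%classic = mu `](a - m) / l, (b - m) / l]%classic.
  rewrite /pushforward; congr (mu _); apply/seteqP; split => x /=; rewrite /F !in_itv/= ltr_pdivrMr// ler_pdivlMr//;
  by rewrite ltrBlDr lerBrDr mulrC.
rewrite !lebesgue_measure_itv/= !lte_fin ltr_pM2r ?invr_gt0// ltrD2r.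
case: ifPn => ab; last by rewrite mule0.
by rewrite -!EFinB -EFinM; congr EFin; field; rewrite gt_eqF.
Qed.

Lemma ge0_integral_affine (l m : R) (f : R -> \bar R) : 0 < l ->
  measurable_fun setT f -> (forall x, 0 <= f x)%E ->
  (\int[mu]_x f x = l%:E * \int[mu]_x f (l * x + m)%R)%E.
Proof.
move=> l0 mf f0; pose k : {nonneg R} := NngNum (ltW l0).
pose F : measurableTypeR R -> measurableTypeR R := fun x => l * x + m.
have mF : measurable_fun setT F by exact: measurable_affine.
pose mF_ := isMeasurableFun.Build _ _ _ _ _ mF.
pose F_ : {mfun measurableTypeR R >-> measurableTypeR R} := HB.pack F mF_.
rewrite (@eq_measure_integral _ _ _ _ (mscale k (pushforward mu F_))); last first.
  by move=> A mA _; exact: lebesgue_measure_affine.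
rewrite ge0_integral_mscale//; congr (_ * _)%E.
by rewrite ge0_integral_pushforward.
Qed.

Lemma measurable_powRB (s p : R) : measurable_fun setT (fun u : R => (u - s) `^ p).
Proof.
by apply: (measurableT_comp (measurable_powR p)); exact: measurable_funD.
Qed.

Lemma measurable_powR_subl (t p : R) :
  measurable_fun setT (fun u : R => (t - u) `^ p).
Proof.
by apply: (measurableT_comp (measurable_powR p)); exact: measurable_funB.
Qed.

(** The Beta kernel on [s, t]: [a] governs the lower end [s], [b] the upper end [t]. With [s = tau]
    and [t = t1] it is the memory kernel of order [a] times the weight of the functional. *)
Definition bker (a b s t u : R) : R := (t - u) `^ (b - 1) * (u - s) `^ (a - 1).

Lemma bker_ge0 a b s t u : 0 <= bker a b s t u.
Proof. by rewrite mulr_ge0 ?powR_ge0. Qed.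

Lemma measurable_bker a b s t : measurable_fun setT (bker a b s t).
Proof.
apply: measurable_funM; [exact: measurable_powR_subl|exact: measurable_powRB].
Qed.

(** Substitution u = (t - s) v + s: the exponent collects 1 from the Jacobian and a - 1, b - 1 from
    the two factors. Extended integrals are used so that the identity can itself prove
    integrability. *)
Lemma ge0_integral_bker_scale a b s t : s < t ->
  (\int[mu]_(u in `]s, t[) (bker a b s t u)%:E =
   ((t - s) `^ (a + b - 1))%:E * \int[mu]_(u in `]0%R, 1%R[) (bker a b 0 1 u)%:E)%E.
Proof.
move=> st; have ts0 : 0 < t - s by rewrite subr_gt0.
rewrite integral_mkcond (@ge0_integral_affine (t - s) s)//; last 2 first.
- apply/(measurable_restrictT _ _).1 => //.
  by apply/measurable_EFinP; apply: measurable_funS (measurable_bker _ _ _ _).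
- by apply: erestrict_ge0 => u _; rewrite lee_fin bker_ge0.
have mb c d : measurable_fun setT ((fun u => (bker a b c d u)%:E) \_ `]c, d[).
  apply/(measurable_restrictT _ _).1 => //.
  by apply/measurable_EFinP; apply: measurable_funS (measurable_bker _ _ _ _).
have b0 c d x : (0 <= ((fun u => (bker a b c d u)%:E) \_ `]c, d[) x)%E.
  by apply: erestrict_ge0 => u _; rewrite lee_fin bker_ge0.
rewrite [X in (_ = _ * X)%E]integral_mkcond.
have mbl : measurable_fun setT
    (fun x : R => ((fun u => (bker a b s t u)%:E) \_ `]s, t[) ((t - s) * x + s)).
  exact: (measurableT_comp (mb s t) (measurable_affine (t - s) s)).
rewrite -(@ge0_integralZl _ _ _ mu setT measurableT _ mbl); last 2 first.
- by move=> x _; exact: b0.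
- by rewrite lee_fin ltW.
rewrite -(@ge0_integralZl _ _ _ mu setT measurableT _ (mb 0 1)); last 2 first.
- by move=> x _; exact: b0.
- by rewrite lee_fin powR_ge0.
apply: eq_integral => u _; rewrite !patchE.
have -> : ((t - s) * u + s \in `]s, t[%classic) = (u \in `]0, 1[%classic).
  apply/idP/idP; rewrite !inE/= !in_itv/= => /andP[u1 u2]; apply/andP.
    move: u1; rewrite ltrDr pmulr_rgt0// => u1; split => //.
    by move: u2; rewrite -ltrBrDr gtr_pMr.
  by rewrite ltrDr pmulr_rgt0// -ltrBrDr gtr_pMr.
case: ifPn; last by rewrite !mule0.
rewrite inE/= in_itv/= => /andP[u0 u1]; rewrite -!EFinM; congr EFin; rewrite /bker.
have -> : t - ((t - s) * u + s) = (t - s) * (1 - u) by ring.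
rewrite addrK subr0 !powRM ?(ltW ts0) ?(ltW u0) ?subr_ge0 ?(ltW u1)//.
have -> : a + b - 1 = 1 + (b - 1) + (a - 1) by ring.
have ts : t - s != 0 by rewrite gt_eqF.
have P x y : (t - s) `^ (x + y) = (t - s) `^ x * (t - s) `^ y.
  by apply: powRD; rewrite ts implybT.
rewrite !P [(t - s) `^ 1]powRr1 ?ltW//; ring.
Qed.

(** The primitive of the power gives a bound independent of the cut-off [e]; monotone convergence
    along e = 1/(n + 1) then yields integrability up to 0. *)
Lemma powR_integral_le (a e : R) : 0 < a -> 0 < e <= 1 ->
  (\int[mu]_(u in `[e, 1%R]) (u `^ (a - 1))%:E <= (a^-1)%:E)%E.
Proof.
move=> a0 /andP[e0]; rewrite le_eqVlt => /predU1P[->|e1].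
  by rewrite set_itv1 integral_set1 lee_fin invr_ge0 ltW.
have D (x : R) : 0 < x -> is_derive x 1 (fun u => a^-1 * u `^ a) (x `^ (a - 1)).
  move=> x0; have h := is_derive1_powR a x0.
  have h2 := @is_deriveZ _ _ _ _ a^-1 _ _ _ h.
  by apply: is_derive_eq h2 _; rewrite /GRing.scale/= mulrA mulVf ?mul1r// gt_eqF.
have ex : forall x : R, e <= x -> 0 < x by move=> x; exact: lt_le_trans.
have cvgD_ (x : R) : derivable (fun u => a^-1 * u `^ a) x 1 ->
    a^-1 * z `^ a @[z --> x] --> a^-1 * x `^ a.
  move=> h; have : {for x, continuous (fun u : R => a^-1 * u `^ a)}.
    exact/differentiable_continuous/derivable1_diffP.
  by [].
rewrite (@continuous_FTC2 _ _ (fun u => a^-1 * u `^ a))//.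
- rewrite /= powR1 mulr1 -EFinB lee_fin lerBlDr lerDl.
  by rewrite mulr_ge0 ?invr_ge0 ?powR_ge0// ltW.
- apply/continuous_in_subspaceT => x; rewrite inE/= in_itv/= => /andP[ex1 _].
  have h := is_derive1_powR (a - 1) (ex _ ex1).
  exact/differentiable_continuous/derivable1_diffP.
- split.
  + by move=> x; rewrite in_itv/= => /andP[ex1 _]; have := D x (ex _ (ltW ex1)) => h.
  + by apply: cvg_at_right_filter; have [h _] := D e e0; exact: cvgD_.
  + by apply: cvg_at_left_filter; have [h _] := D 1 ltr01; exact: cvgD_.
- move=> x; rewrite in_itv/= => /andP[ex1 _]; rewrite derive1E.
  by have := D x (ex _ (ltW ex1)) => h; rewrite derive_val.
Qed.

Lemma powR_integrable01 (a : R) : 0 < a ->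
  mu.-integrable `]0, 1[ (fun u => (u `^ (a - 1))%:E).
Proof.
move=> a0; have m : measurable_fun setT (fun u : R => (u `^ (a - 1))%:E).
  by apply/measurable_EFinP; exact: measurable_powR.
apply/integrableP; split; first exact: measurable_funS m.
under eq_integral do rewrite gee0_abs ?lee_fin ?powR_ge0//.
apply: (@le_lt_trans _ _ (a^-1)%:E); last by rewrite ltry.
pose F (n : nat) := `[(n.+1%:R^-1 : R), 1]%classic.
have F01 n : 0 < (n.+1%:R^-1 : R) <= 1.
  by rewrite invr_gt0 ltr0n/= invf_le1 ?ltr0n// ler1n.
apply: (@le_trans _ _ (\int[mu]_(u in \bigcup_n F n) (u `^ (a - 1))%:E)%E).
  apply: ge0_subset_integral => //=.
  - by apply: bigcup_measurable => n _; exact: measurable_itv.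
  - exact: measurable_funS m.
  - by move=> x _; rewrite lee_fin powR_ge0.
  - move=> x; rewrite /= in_itv/= => /andP[x0 x1].
    have := near_infty_natSinv_lt (PosNum x0) => -[n _ /(_ n (leqnn n))/= h].
    by exists n => //; rewrite /F/= in_itv/= (ltW h) ltW.
have ndF : nondecreasing_seq F.
  apply/nondecreasing_seqP => n; rewrite subsetEset => x; rewrite /F/= !in_itv/=.
  move=> /andP[h ->]; rewrite andbT; apply: le_trans h.
  by rewrite lef_pV2 ?posrE ?ltr0n// ler_nat.
have : (\int[mu]_(x in F i) (x `^ (a - 1))%:E @[i --> \oo] -->
    \int[mu]_(x in \bigcup_i F i) (x `^ (a - 1))%:E)%E.
  apply: (@ge0_nondecreasing_set_cvg_integral _ (measurableTypeR R) R F (fun u : R => (u `^ (a - 1))%:E) lebesgue_measure).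
  - exact: ndF.
  - by move=> i; exact: measurable_itv.
  - by move=> i; exact: measurable_funS m.
  - by move=> i x _; rewrite lee_fin powR_ge0.
move/cvg_lim => <-//; apply: lime_le.
  apply: ereal_nondecreasing_is_cvgn.
  apply: ge0_nondecreasing_set_nondecreasing_integral.
  - exact: ndF.
  - by move=> i; exact: measurable_itv.
  - by move=> i; exact: measurable_funS m.
  - by move=> i x _; rewrite lee_fin powR_ge0.
by apply: nearW => n; exact: powR_integral_le.
Qed.

(** Split at 1/2: on each half only one factor can be singular, and the other is bounded whatever
    the sign of its exponent. *)
Lemma bker01_le (a b u : R) : 0 < u < 1 ->
  bker a b 0 1 u <= (1 + 2^-1 `^ (b - 1) + 2^-1 `^ (a - 1)) *
     (u `^ (a - 1) + (1 - u) `^ (b - 1)).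
Proof.
move=> /andP[u0 u1]; rewrite /bker subr0.
have H (p v : R) : 2^-1 <= v -> v < 1 -> v `^ p <= 1 + 2^-1 `^ p.
  move=> v2 v1; have v0 : 0 < v by apply: lt_le_trans v2; lra.
  have [p0|p0] := leP 0 p.
    have : v `^ p <= v `^ 0 by apply: ger_powR => //; rewrite v0 ltW.
    by rewrite powRr0; have := powR_ge0 (2^-1 : R) p; lra.
  have : v `^ p <= 2^-1 `^ p.
    rewrite -[p]opprK !(powRN _ (- p)) lef_pV2 ?posrE ?powR_gt0//.
    by apply: ge0_ler_powR => //; rewrite ?nnegrE; lra.
  lra.
have A := powR_ge0 u (a - 1); have B := powR_ge0 (1 - u) (b - 1).
have A2 := powR_ge0 (2^-1 : R) (a - 1); have B2 := powR_ge0 (2^-1 : R) (b - 1).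
have [uh|uh] := leP u (2^-1).
  have : (1 - u) `^ (b - 1) <= 1 + 2^-1 `^ (b - 1) by apply: H; lra.
  nra.
have : u `^ (a - 1) <= 1 + 2^-1 `^ (a - 1) by apply: H; lra.
nra.
Qed.

Lemma integrable_itv_cc (s t : R) (f : R -> R) :
  mu.-integrable `]s, t[ (EFin \o f) -> mu.-integrable `[s, t] (EFin \o f).
Proof.
move=> fi; have m1 (r : R) : measurable [set r] by [].
have mst : measurable ([set s] `|` [set t]) by exact: measurableU.
apply/(@negligible_integrable _ _ _ mu `[s, t] ([set s] `|` [set t])) => //.
- apply/measurable_EFinP; apply: measurable_fun_itv_cc.
  by apply/measurable_EFinP; exact: measurable_int fi.
- by apply: countable_lebesgue_measure0; apply: finite_set_countable; rewrite finite_setU.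
- apply: integrableS fi => //; first exact: measurableD.
  move=> x /= [] /=; rewrite !in_itv/= => /andP[sx xt] /not_orP[/eqP xs /eqP xt'].
  by rewrite !lt_neqAle sx xt xt' eq_sym xs.
Qed.

Lemma ge0_integral_opp (f : R -> \bar R) :
  measurable_fun setT f -> (forall x, 0 <= f x)%E ->
  (\int[mu]_x f x = \int[mu]_x f (- x)%R)%E.
Proof.
move=> mf f0.
rewrite (@eq_measure_integral _ _ _ _ (pushforward mu (-%R : _ -> measurableTypeR R))).
  by rewrite ge0_integral_pushforward.
by move=> A mA _; exact/esym/lebesgue_measureN.
Qed.

(** The reflection u -> 1 - u is decomposed into a translation and a sign change, since
    [ge0_integral_affine] takes a positive slope. *)
Lemma onem_powR_integrable01 (b : R) : 0 < b ->
  mu.-integrable `]0, 1[ (fun u => ((1 - u) `^ (b - 1))%:E).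
Proof.
move=> b0; have /integrableP[mi] := powR_integrable01 b0.
under eq_integral do rewrite gee0_abs ?lee_fin ?powR_ge0//.
have m : measurable_fun setT ((fun u : R => (u `^ (b - 1))%:E) \_ `]0, 1[).
  by apply/(measurable_restrictT _ _).1.
have p0 (x : R) : (0%:E <= ((fun u : R => (u `^ (b - 1))%:E) \_ `]0%R, 1%R[) x)%E.
  by apply: erestrict_ge0 => u _; rewrite lee_fin powR_ge0.
have m1 : measurable_fun setT
    (fun x : R => ((fun u : R => (u `^ (b - 1))%:E) \_ `]0, 1[) (1 * x + 1)).
  exact: (measurableT_comp m (measurable_affine 1 1)).
rewrite integral_mkcond (@ge0_integral_affine 1 1)// mul1e ge0_integral_opp// => fi.
apply/integrableP; split.
  apply/measurable_EFinP; apply: measurable_funS (measurable_powR_subl 1 (b - 1)) => //.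
under eq_integral do rewrite gee0_abs ?lee_fin ?powR_ge0//.
rewrite integral_mkcond; apply: le_lt_trans fi; rewrite le_eqVlt; apply/orP; left.
apply/eqP; apply: eq_integral => u _; rewrite !patchE mul1r [1 - u]addrC.
have -> : (- u + 1 \in `]0, 1[%classic) = (u \in `]0, 1[%classic).
  by apply/idP/idP; rewrite !inE/= !in_itv/= => /andP[u1 u2]; apply/andP; split; lra.
by [].
Qed.

Lemma bker_integrable01 (a b : R) : 0 < a -> 0 < b ->
  mu.-integrable `]0, 1[ (EFin \o bker a b 0 1).
Proof.
move=> a0 b0.
pose C := (1 + 2^-1 `^ (b - 1) + 2^-1 `^ (a - 1) : R).
apply: (@le_integrable _ _ _ mu _ _ _ ((fun u => C%:E * ((u `^ (a - 1))%:E + ((1 - u) `^ (b - 1))%:E)%E)%E)) => //.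
- by apply/measurable_EFinP; apply: measurable_funS (measurable_bker _ _ _ _).
- move=> u; rewrite /= in_itv/= => u01.
  rewrite ger0_norm ?bker_ge0// lee_fin ger0_norm; first exact: bker01_le.
  by apply: le_trans (bker_ge0 a b 0 1 u) _; exact: bker01_le.
apply: integrableZl => //; apply: integrableD => //; first exact: powR_integrable01.
exact: onem_powR_integrable01.
Qed.

(** Euler's Beta function. *)
Definition Bt (a b : R) : R := \int[mu]_(u in `]0, 1[) bker a b 0 1 u.

Lemma bker_integrable (a b s t : R) : 0 < a -> 0 < b ->
  mu.-integrable `[s, t] (EFin \o bker a b s t).
Proof.
move=> a0 b0; apply: integrable_itv_cc.
have [st|ts] := ltP s t; last first.
  by rewrite set_itv_ge ?bnd_simp -?leNgt//; exact: integrable_set0.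
apply/integrableP; split.
  by apply/measurable_EFinP; apply: measurable_funS (measurable_bker _ _ _ _).
under eq_integral do rewrite /= ger0_norm ?bker_ge0//.
rewrite ge0_integral_bker_scale//.
have /integrableP[_] := bker_integrable01 a0 b0.
under eq_integral do rewrite /= ger0_norm ?bker_ge0//.
by move=> h; apply: lte_mul_pinfty; rewrite // lee_fin powR_ge0.
Qed.

Lemma integral_bker (a b s t : R) : 0 < a -> 0 < b -> s < t ->
  (\int[mu]_(u in `[s, t]) (bker a b s t u)%:E = ((t - s) `^ (a + b - 1) * Bt a b)%:E)%E.
Proof.
move=> a0 b0 st; rewrite integral_itv_bndoo; last first.
  by apply/measurable_EFinP; apply: measurable_funS (measurable_bker _ _ _ _).
rewrite ge0_integral_bker_scale// EFinM; congr (_ * _)%E.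
rewrite /Bt /Rintegral fineK//; apply: integrable_fin_num => //.
exact: bker_integrable01.
Qed.

Lemma Rintegral_bker (a b s t : R) : 0 < a -> 0 < b -> s < t ->
  \int[mu]_(u in `[s, t]) bker a b s t u = (t - s) `^ (a + b - 1) * Bt a b.
Proof. by move=> a0 b0 st; rewrite /Rintegral integral_bker. Qed.

Lemma integrable_cst (A : set R) (c : R) : measurable A -> (mu A < +oo)%E ->
  mu.-integrable A (fun=> c%:E).
Proof.
move=> mA Aoo; apply/integrableP; split => //.
by rewrite integral_cst//= lte_mul_pinfty.
Qed.

Lemma gt0_Rintegral_itvoo (s t c : R) (f : R -> R) : s < t -> 0 < c ->
  mu.-integrable `]s, t[ (EFin \o f) -> (forall u, u \in `]s, t[ -> c <= f u) ->
  0 < \int[mu]_(u in `]s, t[) f u.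
Proof.
move=> st c0 fi cf; apply: (@lt_le_trans _ _ (\int[mu]_(u in `]s, t[) c)).
  rewrite Rintegral_cst// /= lebesgue_measure_itv/= lte_fin st.
  by rewrite mulr_gt0// -EFinB/= subr_gt0.
apply: le_Rintegral => //; apply: integrable_cst => //.
by rewrite lebesgue_measure_itv/= lte_fin st -EFinB ltry.
Qed.

(** On ]1/4, 1/2[ both factors have a positive lower bound, for either sign of their exponents. *)
Lemma Bt_gt0 (a b : R) : 0 < a -> 0 < b -> 0 < Bt a b.
Proof.
move=> a0 b0; have i := bker_integrable01 a0 b0.
have sub : `]4^-1, 2^-1[%classic `<=` `]0 : R, 1[%classic.
  by move=> x/=; rewrite !in_itv/= => /andP[x0 x1]; apply/andP; split; lra.
have i2 : mu.-integrable `]4^-1, 2^-1[ (EFin \o bker a b 0 1) by exact: integrableS i.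
have h (p v : R) : 4^-1 < v -> v < 1 -> Num.min 1 (4^-1 `^ p) <= v `^ p.
  move=> v4 v1; have v0 : 0 < v by apply: lt_trans v4; rewrite invr_gt0.
  have [p0|p0] := leP 0 p.
    by rewrite ge_min ge0_ler_powR ?orbT// ?nnegrE; lra.
  rewrite ge_min; apply/orP; left; rewrite -{1}(@powRr0 _ v).
  by apply: ger_powR; rewrite ?v0 ltW.
have m0 (p : R) : 0 < Num.min 1 ((4^-1 : R) `^ p).
  by rewrite lt_min ltr01/= powR_gt0// invr_gt0.
apply: (@lt_le_trans _ _ (\int[mu]_(u in `]4^-1, 2^-1[) bker a b 0 1 u)).
  apply: (@gt0_Rintegral_itvoo _ _ (Num.min 1 (4^-1 `^ (b - 1)) * Num.min 1 (4^-1 `^ (a - 1)))) => //.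
  - lra.
  - move=> u; rewrite in_itv/= => /andP[u1 u2]; rewrite /bker subr0.
    by apply: ler_pM; rewrite ?(ltW (m0 _))//; apply: h => //; lra.
rewrite /Bt /Rintegral fine_le//.
- exact: integrable_fin_num i2.
- exact: integrable_fin_num i.
- apply: ge0_subset_integral => //.
    by apply/measurable_EFinP; apply: measurable_funS (measurable_bker _ _ _ _).
  by move=> x _; rewrite lee_fin bker_ge0.
Qed.

(** The majorant is the power on ]0, 1[ plus the exponential; beyond 1 the power is at most 1
    because a <= 1. A real-valued integral is 0 when the extended one is infinite, so positivity of
    [Gamma] has to rest on this. *)
Lemma Gamma_integrable (a : R) : 0 < a <= 1 ->
  mu.-integrable `]0, +oo[ (fun t => (t `^ (a - 1) * expR (- t))%:E).
Proof.
move=> /andP[a0 a1].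
have me : measurable_fun setT (fun t : R => expR (- t)).
  by apply: measurableT_comp => //; exact: measurable_expR.
have mg : measurable_fun setT (fun t : R => t `^ (a - 1) * expR (- t)).
  by apply: measurable_funM => //; exact: measurable_powR.
have E : mu.-integrable `]0, +oo[ (fun t => (expR (- t))%:E).
  have := @integrableS _ _ _ mu setT `]0, +oo[%classic _ measurableT
    (measurable_itv _) (@subsetT _ _) (@integrable_exponential_pdf R 1 ltr01).
  apply: eq_integrable => // x; rewrite inE/= in_itv/= andbT => x0.
  by rewrite exponential_pdfE ?ltW// mul1r mulN1r.
have P : mu.-integrable `]0, +oo[ ((fun t => (t `^ (a - 1))%:E) \_ `]0, 1[).
  have PI : mu.-integrable (`]0, +oo[%classic `&` `]0, 1[%classic : set R)
      (fun t : R => (t `^ (a - 1))%:E).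
    apply: integrableS (powR_integrable01 a0) => //; exact: measurableI.
  exact: (integrable_restrict mu (measurable_itv _) _ _).1 PI.
apply: (@le_integrable _ _ _ mu _ _ _ (fun t : R => ((fun t => (t `^ (a - 1))%:E) \_ `]0%R, 1%R[) t + (expR (- t))%:E)%E) => //.
- by apply/measurable_EFinP; exact: measurable_funS mg.
- move=> t; rewrite /= in_itv/= andbT => t0; rewrite patchE.
  have et0 := expR_ge0 (- t); have pt0 := powR_ge0 t (a - 1).
  case: ifPn => [|/negP]; rewrite inE/= in_itv/= t0/=.
    move=> t1; rewrite lee_fin !ger0_norm ?mulr_ge0 ?addr_ge0//.
    have : expR (- t) <= 1 by rewrite -expR0 ler_expR oppr_le0 ltW.
    nra.
  move=> /negP; rewrite -leNgt => t1; rewrite add0r lee_fin !ger0_norm ?mulr_ge0//.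
  apply: ler_piMl => //; apply: (@le_trans _ _ (t `^ 0)); last by rewrite powRr0.
  by apply: ler_powR => //; lra.
- exact: integrableD.
Qed.

Lemma Gamma_gt0 (a : R) : 0 < a <= 1 -> 0 < Gamma a.
Proof.
move=> a01; have i := Gamma_integrable a01; case/andP: a01 => a0 a1.
have sub : `]0, 1[%classic `<=` `]0 : R, +oo[%classic.
  by move=> x/=; rewrite !in_itv/= => /andP[-> _].
have i2 : mu.-integrable `]0, 1[ (EFin \o (fun t : R => t `^ (a - 1) * expR (- t))).
  exact: integrableS i.
apply: (@lt_le_trans _ _ (\int[mu]_(t in `]0, 1[) (t `^ (a - 1) * expR (- t)))).
  apply: (@gt0_Rintegral_itvoo _ _ (expR (- 1))) => //.
  move=> u; rewrite in_itv/= => /andP[u1 u2].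
  rewrite -[expR (- 1)]mul1r; apply: ler_pM => //; last by rewrite ler_expR lerN2 ltW.
  rewrite -{1}(@powRr0 _ u); apply: ger_powR; last lra.
  by rewrite u1 ltW.
rewrite /Gamma /Rintegral fine_le//.
- exact: integrable_fin_num i2.
- exact: integrable_fin_num i.
- apply: ge0_subset_integral => //; first exact: measurable_int i.
  by move=> x _; rewrite lee_fin mulr_ge0// ?powR_ge0 ?expR_ge0.
Qed.
End beta_kernel.

(** * Composition of the fractional integrals of orders a and 1 - a *)

Section semigroup.
Context {R : realType}.
Notation mu := (@lebesgue_measure R).

Lemma in_set_itv (r : R) (i : interval R) : (r \in [set` i]) = (r \in i).
Proof. by apply/idP/idP => [/set_mem|rI] //; exact/mem_set. Qed.

Lemma EFin_Rintegral (A : set R) (f : R -> R) : measurable A ->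
  mu.-integrable A (EFin \o f) ->
  ((\int[mu]_(x in A) f x)%:E = \int[mu]_(x in A) (f x)%:E)%E.
Proof. by move=> mA fi; rewrite /Rintegral fineK//; exact: integrable_fin_num fi. Qed.

Lemma bounded_measurable_integrable (s t M : R) (f : R -> R) :
  measurable_fun `[s, t] f -> (forall u, u \in `[s, t] -> `|f u| <= M) ->
  mu.-integrable `[s, t] (EFin \o f).
Proof.
move=> mf fM; apply: measurable_bounded_integrable => //=.
  by rewrite lebesgue_measure_itv/=; case: ifPn => //; rewrite -EFinB ltry.
exists M; split; first exact: num_real.
by move=> x xM u /= uI; apply: le_trans (fM _ uI) (ltW xM).
Qed.

Lemma kernel_mul_integrable (a s t M : R) (f : R -> R) : 0 < a ->
  measurable_fun `[s, t] f -> (forall u, u \in `[s, t] -> `|f u| <= M) ->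
  mu.-integrable `[s, t] (EFin \o (fun u => (t - u) `^ (a - 1) * f u)).
Proof.
move=> a0 mf fM.
have i : mu.-integrable `[s, t] (EFin \o (fun u => M * bker 1 a s t u)).
  have -> : EFin \o (fun u => M * bker 1 a s t u) =
    (fun u => M%:E * (EFin \o bker 1 a s t) u)%E by apply/funext => u /=; rewrite EFinM.
  by apply: integrableZl => //; apply: bker_integrable.
apply: le_integrable i => //.
  apply/measurable_EFinP; apply: measurable_funM => //.
  by apply: measurable_funS (measurable_powR_subl t (a - 1)).
move=> u /= uI; rewrite lee_fin /bker subrr powRr0 mulr1 normrM (mulrC M) normrM.
apply: ler_wpM2l => //; apply: le_trans (fM _ uI) _; exact: ler_norm.
Qed.

(* Tonelli in the triangle [t0 <= s <= u <= t]; the inner integral over [u] is a Beta integral. *)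
Lemma fractional_semigroup_ge0 (a t0 t M : R) (f : R -> R) : 0 < a < 1 -> t0 <= t ->
  measurable_fun `[t0, t] f -> (forall s, s \in `[t0, t] -> 0 <= f s <= M) ->
  mu.-integrable `[t0, t] (EFin \o (fun u => (t - u) `^ (1 - a - 1) *
    \int[mu]_(s in `[t0, u]) ((u - s) `^ (a - 1) * f s))) /\
  \int[mu]_(u in `[t0, t]) ((t - u) `^ (1 - a - 1) *
    \int[mu]_(s in `[t0, u]) ((u - s) `^ (a - 1) * f s)) =
  Bt a (1 - a) * \int[mu]_(s in `[t0, t]) f s.
Proof.
move=> /andP[a0 a1] t0t mf fM.
pose g : R -> R := f \_ `[t0, t].
(* Real powers of negative numbers do not vanish in the library, so indicators cut the integrand
   down to the triangle. *)
pose h (v : R) := \1_(`[0, +oo[%classic : set R) v * v `^ (a - 1).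
pose k (u : R) := \1_(`[t0, t]%classic : set R) u * (t - u) `^ (1 - a - 1).
pose K (z : R * R) : \bar R := (k z.1 * (h (z.1 - z.2) * g z.2))%:E.
have mg : measurable_fun setT g by apply/(measurable_restrictT _ _).1.
have mh : measurable_fun setT h.
  by apply: measurable_funM; [exact: measurable_indic|exact: measurable_powR].
have mk : measurable_fun setT k.
  by apply: measurable_funM; [exact: measurable_indic|exact: measurable_powR_subl].
have mK : measurable_fun setT K.
  apply/measurable_EFinP; apply: measurable_funM; first exact: measurableT_comp mk _.
  apply: measurable_funM; last exact: measurableT_comp mg _.
  by apply: (measurableT_comp mh); exact: measurable_funB.
have g0 s : 0 <= g s.
  rewrite /g patchE; case: ifPn => //; rewrite inE => /fM /andP[] //.
have h0 v : 0 <= h v by rewrite mulr_ge0// ?powR_ge0.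
have k0 v : 0 <= k v by rewrite mulr_ge0// ?powR_ge0.
have K0 z : (0 <= K z)%E.
  by rewrite /K lee_fin; apply: mulr_ge0 => //; apply: mulr_ge0.
have mI r : r \in `[t0, t] -> (r \in `[t0, t]%classic) = true.
  by rewrite in_set_itv.
have fi u : u \in `[t0, t] -> mu.-integrable `[t0, u] (EFin \o (fun s => (u - s) `^ (a - 1) * f s)).
  rewrite in_itv/= => /andP[t0u ut].
  have sub : `[t0, u]%classic `<=` `[t0, t]%classic.
    by move=> x/=; rewrite !in_itv/= => /andP[-> xu]; apply: le_trans ut.
  apply: (@kernel_mul_integrable _ _ _ M) => //; first exact: measurable_funS mf.
  by move=> s /sub /fM /andP[fs0 fsM]; rewrite ger0_norm.
have inner u : u \in `[t0, t] -> (\int[mu]_s K (u, s) =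
   ((t - u) `^ (1 - a - 1) * \int[mu]_(s in `[t0, u]) ((u - s) `^ (a - 1) * f s))%:E)%E.
  move=> uI; have := uI; rewrite in_itv/= => /andP[t0u ut].
  have i := fi u uI; rewrite EFinM /Rintegral fineK; last exact: integrable_fin_num i.
  rewrite -ge0_integralZl//; last 3 first.
  - exact: measurable_int i.
  - move=> s; rewrite /= in_itv/= => /andP[t0s su]; rewrite lee_fin mulr_ge0 ?powR_ge0//.
    by have /andP[] : 0 <= f s <= M by apply: fM; rewrite in_itv/= t0s (le_trans su).
  - by rewrite lee_fin powR_ge0.
  rewrite [RHS]integral_mkcond; apply: eq_integral => s _.
  rewrite patchE /K /k /h /g /= !indicE patchE (mI _ uI) mul1r.
  have -> : (u - s \in `[0, +oo[%classic) = (s <= u).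
    by rewrite in_set_itv in_itv/= andbT subr_ge0.
  have -> : (s \in `[t0, u]%classic) = (s <= u) && (s \in `[t0, t]%classic).
    rewrite !in_set_itv !in_itv/=; apply/idP/idP.
      by move=> /andP[-> su]; rewrite su/= (le_trans su).
    by move=> /andP[-> /andP[->]].
  case: (s <= u) => /=; last by rewrite !mul0r mulr0.
  by case: ifPn => _; rewrite mul1r ?mulr0.
have outer s : s \in `[t0, t[ -> (\int[mu]_u K (u, s) = (Bt a (1 - a) * f s)%:E)%E.
  move=> sI; have := sI; rewrite in_itv/= => /andP[t0s st].
  have sI' : s \in `[t0, t] by rewrite in_itv/= t0s ltW.
  have f0 : 0 <= f s by have /andP[] := fM _ sI'.
  (* The scaling exponent a + (1 - a) - 1 is 0: the Beta integral does not depend on [s], which is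
     the whole reason for the semigroup law. *)
  have -> : Bt a (1 - a) = (t - s) `^ (a + (1 - a) - 1) * Bt a (1 - a).
    by rewrite (_ : a + (1 - a) - 1 = 0) ?powRr0 ?mul1r//; ring.
  rewrite mulrC EFinM -integral_bker//; last lra.
  rewrite -ge0_integralZl//; last 2 first.
  - by apply/measurable_EFinP; apply: measurable_funS (measurable_bker _ _ _ _).
  - by move=> u _; rewrite lee_fin bker_ge0.
  rewrite [RHS]integral_mkcond; apply: eq_integral => u _.
  rewrite patchE /K /k /h /g /= !indicE patchE (mI _ sI').
  have -> : (u - s \in `[0, +oo[%classic) = (s <= u).
    by rewrite in_set_itv in_itv/= andbT subr_ge0.
  have -> : (u \in `[s, t]%classic) = (s <= u) && (u \in `[t0, t]%classic).
    rewrite !in_set_itv !in_itv/=; apply/idP/idP.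
      by move=> /andP[su ->]; rewrite su/= (le_trans t0s).
    by move=> /andP[-> /andP[_ ->]].
  case: (s <= u) => /=; last by rewrite !mul0r mulr0.
  case: ifPn => _; rewrite !mul1r ?mul0r//.
  by rewrite -EFinM /bker; congr EFin; ring.
have fI : mu.-integrable `[t0, t] (EFin \o f).
  by apply: (@bounded_measurable_integrable _ _ M) => // s /fM /andP[? ?]; rewrite ger0_norm.
have mF := @measurable_fun_fubini_tonelli_F _ _ (measurableTypeR R) (measurableTypeR R) R mu K mK K0.
have E : (\int[mu]_(u in `[t0, t]) ((t - u) `^ (1 - a - 1) *
    \int[mu]_(s in `[t0, u]) ((u - s) `^ (a - 1) * f s))%:E =
  (Bt a (1 - a) * \int[mu]_(s in `[t0, t]) f s)%:E)%E.
  transitivity (\int[mu]_u \int[mu]_s K (u, s))%E.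
    rewrite integral_mkcond; apply: eq_integral => u _; rewrite patchE.
    case: ifPn; first by rewrite inE => /inner ->.
    move=> uI; rewrite integral0_eq// => s _.
    by rewrite /K /k /= indicE (negbTE uI) !mul0r.
  rewrite (@fubini_tonelli _ _ _ _ _ mu mu K)//.
  have -> : ((Bt a (1 - a) * \int[mu]_(s in `[t0, t]) f s)%:E =
      (Bt a (1 - a))%:E * \int[mu]_(s in `[t0, t]) (f s)%:E)%E.
    by rewrite EFinM (@EFin_Rintegral _ f).
  rewrite -ge0_integralZl//; last 3 first.
  - exact: measurable_int fI.
  - by move=> s /fM /andP[? _]; rewrite lee_fin.
  - by rewrite lee_fin ltW// Bt_gt0//; lra.
  (* [outer] is available only for s < t, since at s = t the Beta integral degenerates; the endpoint
     is dropped as a null set on both sides. *)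
  rewrite -integral_itv_bndo_bndc; last first.
    apply: emeasurable_funM => //; apply: measurable_funS (measurable_int _ fI) => //.
    by move=> x /=; rewrite !in_itv/= => /andP[-> /ltW].
  rewrite [RHS]integral_mkcond.
  rewrite -[LHS](@integral_setD1 _ _ t); last 2 first.
  - exact: measurableD.
  - by apply: measurable_funS (@measurable_fun_fubini_tonelli_G _ _ (measurableTypeR R) (measurableTypeR R) R mu K mK K0).
  rewrite [LHS]integral_mkcond; apply: eq_integral => s _; rewrite !patchE.
  rewrite in_set_itv; have [sI|sI] := boolP (s \in `[t0, t[).
    rewrite ifT; first by rewrite -EFinM; exact: outer.
    by rewrite inE; split => // st; move: sI; rewrite st/= in_itv/= ltxx andbF.
  case: ifPn => //; rewrite inE => -[_ /= /eqP st].
  rewrite integral0_eq// => u _; rewrite /K /g /= patchE in_set_itv ifF ?mulr0//.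
  apply/negbTE; apply: contra sI; rewrite !in_itv/= => /andP[-> ].
  by rewrite le_eqVlt (negbTE st).
split.
  apply/integrableP; split.
    apply: (eq_measurable_fun (fun u => \int[mu]_s K (u, s))%E).
      by move=> u; rewrite inE => /inner.
    exact: measurable_funS mF.
  under eq_integral => u uI.
    rewrite /= ger0_norm; last first.
      rewrite mulr_ge0 ?powR_ge0// Rintegral_ge0// => s.
      rewrite /= in_itv/= => /andP[t0s su]; rewrite mulr_ge0 ?powR_ge0//.
      have : s \in `[t0, t].
        by move: uI; rewrite inE/= !in_itv/= t0s => /andP[_]; exact: le_trans.
      by move=> /fM /andP[].
    over.
  by rewrite E ltry.
by rewrite {1}/Rintegral E.
Qed.

(** Tonelli needs a sign, but both sides are linear in [f], and [f] is the difference of the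
    nonnegative bounded functions f + M and M. The integrability obtained with the nonnegative case
    allows the subtraction. *)
Lemma fractional_semigroup (a t0 t M : R) (f : R -> R) : 0 < a < 1 -> t0 <= t ->
  measurable_fun `[t0, t] f -> (forall s, s \in `[t0, t] -> `|f s| <= M) ->
  \int[mu]_(u in `[t0, t]) ((t - u) `^ (1 - a - 1) *
    \int[mu]_(s in `[t0, u]) ((u - s) `^ (a - 1) * f s)) =
  Bt a (1 - a) * \int[mu]_(s in `[t0, t]) f s.
Proof.
move=> a01 t0t mf fM; have /andP[a0 a1] := a01.
have M0 : 0 <= M by apply: le_trans (normr_ge0 (f t0)) _; apply: fM; rewrite in_itv/= lexx.
have mf1 : measurable_fun `[t0, t] (fun s => f s + M) by exact: measurable_funD.
have [|i1 e1] := @fractional_semigroup_ge0 a t0 t (M + M) _ a01 t0t mf1.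
  by move=> s /fM; rewrite ler_norml => /andP[? ?]; apply/andP; split; lra.
have [||i2 e2] := @fractional_semigroup_ge0 a t0 t M (fun=> M) a01 t0t.
- exact: measurable_cst.
- by move=> s _; rewrite M0 lexx.
have fI : mu.-integrable `[t0, t] (EFin \o f) by exact: bounded_measurable_integrable fM.
have MI : mu.-integrable `[t0, t] (EFin \o (fun=> M)).
  by apply: (@bounded_measurable_integrable _ _ M) => // s _; rewrite ger0_norm.
move: e1; rewrite RintegralD// mulrDr -e2 => /eqP; rewrite -subr_eq => /eqP <-.
rewrite -RintegralB//; apply: eq_Rintegral => u; rewrite inE/= in_itv/= => /andP[t0u ut].
rewrite -mulrBr; congr (_ * _).
have sub : `[t0, u]%classic `<=` `[t0, t]%classic.
  by move=> x/=; rewrite !in_itv/= => /andP[-> xu]; apply: le_trans ut.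
have mfu : measurable_fun `[t0, u] f by exact: measurable_funS mf.
rewrite -RintegralB//.
- by apply: eq_Rintegral => s _; ring.
- apply: (@kernel_mul_integrable _ _ _ (M + M)) => //; first exact: measurable_funD.
  by move=> s /sub /fM; rewrite !ler_norml => /andP[? ?]; apply/andP; split; lra.
- by apply: (@kernel_mul_integrable _ _ _ M) => // s _; rewrite ger0_norm.
Qed.
End semigroup.

(** * Boundedness and measurability of piecewise continuous functions *)

Section piecewise_continuous.
Context {R : realType} {n : nat}.
Notation mu := (@lebesgue_measure R).
Implicit Types (psi : R -> 'rV[R]_n.+1) (D : set R).

Lemma finite_set_measurable (D : set R) : finite_set D -> measurable D.
Proof. by move=> /finite_set_countable; exact: countable_measurable. Qed.

Lemma finite_set_null (D : set R) : finite_set D -> mu D = 0%E.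
Proof. by move=> /finite_set_countable; exact: countable_lebesgue_measure0. Qed.

Lemma measurable_fun_setD_finite (A D : set R) (f : R -> R) : measurable A ->
  finite_set D -> measurable_fun (A `\` D) f -> measurable_fun A f.
Proof.
move=> mA fD mf _ Y mY.
have -> : A `&` f @^-1` Y = ((A `\` D) `&` f @^-1` Y) `|` (A `&` D `&` f @^-1` Y).
  apply/seteqP; split => x /=.
    by move=> [Ax Yx]; have [Dx|Dx] := pselect (D x); [right|left].
  by move=> [[[]]|[[]]].
apply: measurableU; first by apply: mf => //; apply: measurableD => //; exact: finite_set_measurable fD.
have fA : finite_set (A `&` D `&` f @^-1` Y) by apply: sub_finite_set fD => x [[]].
exact: finite_set_measurable fA.
Qed.

Lemma le_coord (m : nat) (v : 'rV[R]_m.+1) i : `|v 0 i| <= `|v|.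
Proof. by rewrite [leRHS]/Num.norm/= mx_normrE; exact: (@le_bigmax _ _ _ 0 (fun ij => `|v ij.1 ij.2|) (0, i)). Qed.

Lemma le_rV_norm (m : nat) (v : 'rV[R]_m.+1) (e : R) : 0 <= e ->
  (forall i, `|v 0 i| <= e) -> `|v| <= e.
Proof.
move=> e0 h; rewrite /Num.norm/= mx_normrE; apply/bigmax_leP; split => //= -[i j] _ /=.
by rewrite ord1.
Qed.

(** At a jump the value is unrelated to the one-sided limits, so the bound adds all three. *)
Lemma PC_locally_bounded (t0 t1 : R) psi t : PC t0 t1 psi -> t \in `[t0, t1] ->
  exists M : R, \forall s \near t, s \in `[t0, t1] -> `|psi s| <= M.
Proof.
move=> [D [fD Dsub cD lD]] tI.
have bd (F : set_system R) (l : 'rV[R]_n.+1) : Filter F -> psi s @[s --> F] --> l ->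
    \forall s \near F, `|psi s| <= `|l| + 1.
  move=> FF /cvgrPdist_lt /(_ 1 ltr01); apply: filterS => s ls.
  have -> : psi s = l - (l - psi s) by rewrite subKr.
  by apply: le_trans (ler_normB _ _) _; rewrite lerD2l ltW.
have [Dt|Dt] := pselect (D t); last first.
  have H := bd _ _ (within_filter _ (nbhs_filter t)) (cD t tI Dt); exists (`|psi t| + 1).
  by rewrite near_withinE in H.
have [/cvg_ex[l1 c1] /cvg_ex[l2 c2]] := lD t Dt.
exists (`|psi t| + (`|l1| + 1) + (`|l2| + 1)).
have h1 := bd _ _ (within_filter _ (nbhs_filter t)) c1.
have h2 := bd _ _ (within_filter _ (nbhs_filter t)) c2.
rewrite !near_withinE in h1 h2; near=> s => sI.
have [st|ts|->] := ltgtP s t.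
- have : `|psi s| <= `|l1| + 1 by move: st; near: s.
  by have := normr_ge0 (psi t); have := normr_ge0 l2; lra.
- have : `|psi s| <= `|l2| + 1 by move: ts; near: s.
  by have := normr_ge0 (psi t); have := normr_ge0 l1; lra.
- by have := normr_ge0 l1; have := normr_ge0 l2; lra.
Unshelve. all: by end_near. Qed.

(** Compactness of the segment, with the bound itself as a parameter tending to +oo, so that one
    large value serves all local bounds. *)
Lemma PC_bounded (t0 t1 : R) psi : PC t0 t1 psi ->
  exists M : R, forall s, s \in `[t0, t1] -> `|psi s| <= M.
Proof.
move=> pc.
have := @segment_compact R t0 t1 => /compact_near_coveringP.
move=> /(_ R +oo%R (fun M s => s \in `[t0, t1] -> `|psi s| <= M)).
case.
- move=> t tI; have [M hM] := PC_locally_bounded pc tI.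
  exists ([set s | s \in `[t0, t1] -> `|psi s| <= M], [set m | M <= m]).
    split => //=; exact: nbhs_pinfty_ge (num_real _).
  by move=> [s m] /= [h Mm] sI; apply: le_trans (h sI) Mm.
- move=> M [_ h]; exists (M + 1) => s sI; apply: (h (M + 1)) => //; lra.
Qed.

Lemma PC_measurable (t0 t1 : R) psi i : PC t0 t1 psi ->
  measurable_fun `[t0, t1] (fun s => psi s 0 i).
Proof.
move=> [D [fD Dsub cD lD]]; apply: (measurable_fun_setD_finite _ fD) => //.
apply: subspace_continuous_measurable_fun.
  by apply: measurableD => //; exact: finite_set_measurable.
apply/subspace_continuousP => t [/= tI Dt].
apply: (@cvg_trans _ ((fun s => psi s 0 i) @ within `[t0, t1]%classic (nbhs t))).
  by apply: cvg_app; apply: within_subset => s [].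
apply: (@cvg_comp _ _ _ psi (fun v : 'rV[R]_n.+1 => v 0 i) _ _ _ (cD t tI Dt)).
exact: coord_continuous.
Qed.

Lemma PC_coord_bounded (t0 t1 : R) psi : PC t0 t1 psi ->
  exists M : R, forall i s, s \in `[t0, t1] -> `|psi s 0 i| <= M.
Proof.
move=> /PC_bounded[M h]; exists M => i s sI.
by apply: le_trans (h s sI); exact: le_coord.
Qed.

End piecewise_continuous.

(** * Caputo derivative of a fractional integral *)

Section caputo.
Context {R : realType} {n : nat}.
Notation mu := (@lebesgue_measure R).
Implicit Types (psi phi g : R -> 'rV[R]_n.+1).

Lemma Rintegral_increment (f : R -> R) (t0 s t v e : R) : t0 <= s -> s <= t ->
  mu.-integrable `[t0, t] (EFin \o f) -> (forall u, u \in `[s, t] -> `|f u - v| <= e) ->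
  `|\int[mu]_(u in `[t0, t]) f u - \int[mu]_(u in `[t0, s]) f u - (t - s) * v| <= e * (t - s).
Proof.
move=> t0s st fi fe.
have mst : (mu `]s, t] < +oo)%E.
  by rewrite lebesgue_measure_itv/=; case: ifPn => //; rewrite -EFinB ltry.
have lst : fine (mu `]s, t]) = t - s.
  rewrite lebesgue_measure_itv/= lte_fin; case: (ltP s t) => [_|ts].
    by rewrite -EFinB.
  by rewrite (@le_anti _ _ s t) ?st ?ts// subrr.
have fi' : mu.-integrable `]s, t] (EFin \o f).
  by apply: integrableS fi => // u /=; rewrite !in_itv/= => /andP[/ltW/(le_trans t0s) -> ->].
have ci (c : R) : mu.-integrable `]s, t] (EFin \o (fun=> c)) by exact: integrable_cst.
rewrite Rintegral_itvB//.
have <- : \int[mu]_(u in `]s, t]) v = (t - s) * v by rewrite Rintegral_cst// lst mulrC.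
rewrite -RintegralB//; apply: le_trans (le_normr_Rintegral _ _) _ => //.
  by apply: eq_integrable (integrableB _ fi' (ci v)).
have <- : \int[mu]_(u in `]s, t]) e = e * (t - s) by rewrite Rintegral_cst// lst.
apply: le_Rintegral => //.
  apply: (@integrable_norm _ _ _ mu _ (fun u => f u - v)).
  by apply: eq_integrable (integrableB _ fi' (ci v)).
by move=> u /=; rewrite in_itv/= => /andP[/ltW su ut]; apply: fe; rewrite in_itv/= su.
Qed.

(** Makes the limit in [derive_on] unique, also at the two ends of the segment. *)
Lemma within_itv_dnbhs_proper (t0 t1 t : R) : t0 < t1 -> t \in `[t0, t1] ->
  ProperFilter (within `[t0, t1]%classic t^').
Proof.
move=> t01; rewrite in_itv/= => /andP[t0t tt1]; split; last exact: within_filter.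
rewrite /within/= => /nbhs_ballP[d /= d0 h].
have [tt|] := ltP t t1.
  pose s := t + Num.min (d / 2) (t1 - t).
  have m0 : 0 < Num.min (d / 2) (t1 - t) by rewrite lt_min divr_gt0//= subr_gt0.
  have m1 : Num.min (d / 2) (t1 - t) <= d / 2 by rewrite ge_min lexx.
  have m2 : Num.min (d / 2) (t1 - t) <= t1 - t by rewrite ge_min lexx orbT.
  apply: (h s).
  - by rewrite /ball/= /s opprD addNKr normrN gtr0_norm//; lra.
  - by apply/eqP; rewrite /s; lra.
  - by rewrite /= in_itv/= /s; lra.
move=> t1t; have {}t1t : t = t1 by apply/eqP; rewrite eq_le tt1.
pose s := t - Num.min (d / 2) (t - t0).
have m0 : 0 < Num.min (d / 2) (t - t0) by rewrite lt_min divr_gt0//= subr_gt0 t1t.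
have m1 : Num.min (d / 2) (t - t0) <= d / 2 by rewrite ge_min lexx.
have m2 : Num.min (d / 2) (t - t0) <= t - t0 by rewrite ge_min lexx orbT.
apply: (h s).
- by rewrite /ball/= /s subKr gtr0_norm//; lra.
- by apply/eqP; rewrite /s; lra.
- by rewrite /= in_itv/= /s; lra.
Qed.

(** Near a continuity point the mean of [psi] over a short interval is close to its value; the
    intervals stay inside [t0, t1], which covers the one-sided derivatives at the ends. The factor
    [c] receives the constant of the semigroup law. *)
Lemma derive_on_primitive (t0 t1 c : R) psi g t : t0 < t1 -> PC t0 t1 psi ->
  (forall s i, s \in `[t0, t1] ->
    g s 0 i = g t0 0 i + c * \int[mu]_(u in `[t0, s]) psi u 0 i) ->
  t \in `[t0, t1] -> continuous_on_at t0 t1 psi t ->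
  derive_on t0 t1 g t = c *: psi t.
Proof.
move=> t01 pc gE tI ct; have PF := within_itv_dnbhs_proper t01 tI.
apply: cvg_lim; first exact: norm_hausdorff.
apply/cvgrPdist_le => e e0; pose e' := e / (`|c| + 1).
have c1 : 0 < `|c| + 1 by rewrite ltr_wpDl.
have e'0 : 0 < e' by rewrite divr_gt0.
move/cvgrPdist_le : ct => /(_ e' e'0); rewrite !near_withinE => /nbhs_ballP[d /= d0 h].
apply/nbhs_ballP; exists d => //= s ds /eqP st sI.
have [M hM] := PC_coord_bounded pc.
apply: le_rV_norm; first exact: ltW.
move=> i; rewrite !mxE.
have fi r : r \in `[t0, t1] -> mu.-integrable `[t0, r] (EFin \o (fun u => psi u 0 i)).
  rewrite in_itv/= => /andP[t0r rt1].
  have sub : `[t0, r]%classic `<=` `[t0, t1]%classic.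
    by move=> x/=; rewrite !in_itv/= => /andP[-> xu]; apply: le_trans rt1.
  apply: (@bounded_measurable_integrable _ _ _ M).
    exact: measurable_funS (PC_measurable i pc).
  by move=> u /sub; exact: hM.
pose P r := \int[mu]_(u in `[t0, r]) psi u 0 i.
have cl u : u \in `[t0, t1] -> `|t - u| < d -> `|psi u 0 i - psi t 0 i| <= e'.
  move=> uI tu; have := le_coord (psi t - psi u) i; rewrite !mxE distrC => /le_trans; apply.
  by apply: h.
have key : `|P s - P t - (s - t) * psi t 0 i| <= e' * `|s - t|.
  move: tI (sI) ds; rewrite /ball/= !in_itv/= => /andP[t0t tt1] /andP[t0s st1] ds.
  have [ts|st'] := leP t s.
    rewrite (@ger0_norm _ (s - t)) ?subr_ge0//.
    apply: Rintegral_increment => //; first by apply: fi; rewrite in_itv/= t0s.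
    move=> u; rewrite in_itv/= => /andP[tu us]; apply: cl.
      by rewrite in_itv/= (le_trans t0t)//= (le_trans us).
    by move: ds; rewrite !ler0_norm ?subr_le0//; lra.
  rewrite (@ltr0_norm _ (s - t)) ?subr_lt0// opprB.
  have -> : P s - P t - (s - t) * psi t 0 i = - (P t - P s - (t - s) * psi t 0 i) by ring.
  rewrite normrN; apply: Rintegral_increment => //; first exact: ltW.
    by apply: fi; rewrite in_itv/= t0t.
  move=> u; rewrite in_itv/= => /andP[tu us]; apply: cl.
    by rewrite in_itv/= (le_trans t0s)//= (le_trans us).
  by move: ds; rewrite !ger0_norm ?subr_ge0//; lra.
have nst : s - t != 0 by rewrite subr_eq0; apply/eqP => stE; apply: st.
rewrite (gE s) ?inE// (gE t) ?inE// -/(P s) -/(P t).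
have -> : c * psi t 0 i - (s - t)^-1 * (g t0 0 i + c * P s - (g t0 0 i + c * P t)) =
   - (c * ((s - t)^-1 * (P s - P t - (s - t) * psi t 0 i))) by field.
rewrite normrN !normrM normfV.
have h1 : `|s - t|^-1 * `|P s - P t - (s - t) * psi t 0 i| <= e'.
  by rewrite mulrC ler_pdivrMr ?normr_gt0.
apply: le_trans (ler_wpM2l _ h1) _ => //.
by rewrite /e' mulrA ler_pdivrMr// mulrC; apply: ler_wpM2l; [exact: ltW|rewrite lerDl].
Qed.

(* The reflection formula makes this constant 1.  Only its positivity is used: the variation is
   rescaled by its inverse, so neither [Gamma 1] nor the Beta-Gamma relation has to be computed. *)
Definition caputo_cst (a : R) : R :=
  if a == 1 then (Gamma a)^-1 else Bt a (1 - a) / (Gamma a * Gamma (1 - a)).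

Lemma caputo_cst_gt0 a : 0 < a <= 1 -> 0 < caputo_cst a.
Proof.
move=> /andP[a0 a1]; rewrite /caputo_cst; case: ifPn => [_|a1'].
  by rewrite invr_gt0 Gamma_gt0// a0.
have {}a1 : a < 1 by rewrite lt_neqAle a1'.
by rewrite divr_gt0 ?mulr_gt0 ?Bt_gt0 ?Gamma_gt0//; lra.
Qed.

Lemma frac_int_start (a t0 : R) phi : frac_int a t0 phi t0 = 0.
Proof. by apply/rowP => i; rewrite !mxE set_itv1 Rintegral_set1 mulr0. Qed.

Lemma Riemann_Liouville_semigroup (a t0 s M : R) (f : R -> R) : 0 < a < 1 -> t0 <= s ->
  measurable_fun `[t0, s] f -> (forall u, u \in `[t0, s] -> `|f u| <= M) ->
  (Gamma (1 - a))^-1 * \int[mu]_(u in `[t0, s]) ((s - u) `^ (1 - a - 1) *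
    ((Gamma a)^-1 * \int[mu]_(r in `[t0, u]) ((u - r) `^ (a - 1) * f r))) =
  Bt a (1 - a) / (Gamma a * Gamma (1 - a)) * \int[mu]_(u in `[t0, s]) f u.
Proof.
move=> a01 t0s mf fM; have /andP[a0 a1] := a01.
have G0 : 0 <= (Gamma a)^-1 by rewrite invr_ge0 ltW// Gamma_gt0// a0 ltW.
have sub u : u \in `[t0, s] -> `[t0, u]%classic `<=` `[t0, s]%classic.
  rewrite in_itv/= => /andP[_ us].
  by move=> x/=; rewrite !in_itv/= => /andP[-> xu]; apply: le_trans us.
transitivity ((Gamma (1 - a))^-1 * \int[mu]_(u in `[t0, s]) ((s - u) `^ (1 - a - 1) *
    \int[mu]_(r in `[t0, u]) ((u - r) `^ (a - 1) * ((Gamma a)^-1 * f r)))).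
  congr (_ * _); apply: eq_Rintegral => u; rewrite inE => uI; congr (_ * _).
  rewrite -RintegralZl//.
    by apply: eq_Rintegral => r _; rewrite mulrCA.
  apply: (@kernel_mul_integrable _ _ _ _ M) => //.
    by apply: measurable_funS mf => //; exact: sub.
  by move=> r /(sub _ uI); exact: fM.
rewrite (@fractional_semigroup _ _ _ _ ((Gamma a)^-1 * M))//.
- rewrite RintegralZl//; last exact: (@bounded_measurable_integrable _ _ _ M).
  move: (Gamma a) (Gamma (1 - a)) (Bt _ _) (Rintegral _ _ _) => x y z w.
  by rewrite invfM; ring.
- by apply: measurable_funM.
- move=> r rI; rewrite normrM ger0_norm//.
  by apply: ler_wpM2l => //; exact: fM.
Qed.

(** At order 1 the kernel is constant and [phi] is already a primitive, up to the inverse of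
    [Gamma 1]. Below order 1 the semigroup law turns the integral of order 1 - a of [phi] minus its
    initial value into a primitive of [psi]. Both cases end with the same derivative lemma. *)
Lemma caputo_frac_int (a t0 t1 : R) psi phi t : 0 < a <= 1 -> t0 < t1 -> PC t0 t1 psi ->
  (forall t, t \in `[t0, t1] -> phi t = phi t0 + frac_int a t0 psi t) ->
  t \in `[t0, t1] -> continuous_on_at t0 t1 psi t ->
  caputo a t0 t1 phi t = caputo_cst a *: psi t.
Proof.
move=> /andP[a0 a1] t01 pc phiE tI ct; apply: derive_on_primitive => // s i sI.
have [M hM] := PC_coord_bounded pc.
rewrite /caputo_cst; case: ifPn => [/eqP a1E|a1'].
  rewrite (phiE s sI) !mxE; congr (_ + _ * _); apply: eq_Rintegral => u _.
  by rewrite a1E subrr powRr0 mul1r.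
have {}a1 : a < 1 by rewrite lt_neqAle a1'.
have z0 : frac_int (1 - a) t0 (fun s => phi s - phi t0) t0 0 i = 0.
  by rewrite frac_int_start mxE.
have sub r : r \in `[t0, t1] -> `[t0, r]%classic `<=` `[t0, t1]%classic.
  rewrite in_itv/= => /andP[_ rt1].
  by move=> x/=; rewrite !in_itv/= => /andP[-> xu]; apply: le_trans rt1.
rewrite z0 add0r -(@Riemann_Liouville_semigroup _ _ _ M) ?a0//; first last.
- by move=> r /(sub _ sI); exact: hM.
- by apply: measurable_funS (PC_measurable i pc) => //; exact: sub.
- by move: sI; rewrite in_itv/= => /andP[].
rewrite mxE; congr (_ * _); apply: eq_Rintegral => u; rewrite inE => uI; congr (_ * _).
by rewrite (phiE u (sub _ sI _ uI)) addrAC subrr add0r mxE.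
Qed.

End caputo.

(** * Uniform bounds and a Lipschitz constant for L near the graph *)

Section graph_neighbourhood.
Context {R : realType} {n : nat}.
Notation mu := (@lebesgue_measure R).
Notation E := (R * 'rV[R]_n.+1 * 'rV[R]_n.+1)%type.

(** A neighbourhood of [t] contains an open interval inside ]t0, t1[, even when [t] is an end; its
    positive measure prevents it from lying in a null set. *)
Lemma exists_near_notin_finite (t0 t1 t : R) (D P : set R) : t0 < t1 ->
  t \in `[t0, t1] -> finite_set D -> nbhs t P ->
  exists s, [/\ s \in `]t0, t1[, ~ D s & P s].
Proof.
move=> t01; rewrite in_itv/= => /andP[t0t tt1] fD /nbhs_ballP[d /= d0 dP].
pose lo := Num.max (t - d) t0; pose hi := Num.min (t + d) t1.
have lohi : lo < hi by rewrite lt_min !gt_max; lra.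
apply: contrapT => nex.
have sub : `]lo, hi[%classic `<=` D.
  move=> s; rewrite /= in_itv/= lt_min gt_max => /andP[/andP[a1 a2] /andP[a3 a4]].
  apply: contrapT => Ds; apply: nex; exists s; split => //; first by rewrite in_itv/= a2.
  by apply: dP; rewrite /ball/= ltr_norml; apply/andP; split; lra.
have : (mu `]lo, hi[ <= mu D)%E.
  by apply: le_measure; rewrite ?inE//; exact: finite_set_measurable.
rewrite (finite_set_null fD) lebesgue_measure_itv/= lte_fin lohi -EFinB lee_fin; lra.
Qed.

(** [D] is the jump set of [psi]. Its complement is open, so the formula for the derivative holds on
    a whole relative neighbourhood of each point outside [D], and continuity of [psi] passes to
    [caputo]. *)
Lemma caputo_PCa (a t0 t1 : R) (psi phi : R -> 'rV[R]_n.+1) : 0 < a <= 1 -> t0 < t1 ->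
  PC t0 t1 psi ->
  (forall t, t \in `[t0, t1] -> phi t = phi t0 + frac_int a t0 psi t) ->
  exists D : set R, [/\ finite_set D, D `<=` `]t0, t1[%classic,
   forall t, t \in `[t0, t1] -> ~ D t -> caputo a t0 t1 phi t = caputo_cst a *: psi t,
   forall t, t \in `[t0, t1] -> ~ D t -> continuous_on_at t0 t1 psi t
   & forall t, t \in `[t0, t1] -> ~ D t -> cont_points a t0 t1 phi t].
Proof.
move=> a01 t01 pc phiE; have [D [fD Dsub cD _]] := pc.
have cE t : t \in `[t0, t1] -> ~ D t -> caputo a t0 t1 phi t = caputo_cst a *: psi t.
  by move=> tI Dt; apply: caputo_frac_int => //; exact: cD.
exists D; split => // t tI Dt; split => //; rewrite /continuous_on_at (cE t tI Dt).
have cc : (fun s => caputo_cst a *: psi s) @ within `[t0, t1]%classic (nbhs t)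
    --> caputo_cst a *: psi t.
  by apply: cvgZr; exact: cD.
apply: cvg_trans cc; apply: near_eq_cvg; rewrite near_withinE.
have : nbhs t (~` D).
  apply: open_nbhs_nbhs; split => //; apply: closed_openC.
  by apply: compact_closed; [exact: norm_hausdorff|exact: finite_compact].
by apply: filterS => s Ds sI; rewrite cE.
Qed.

(** A continuity point may belong to the exceptional set, where the derivative has no formula. It is
    compared with a nearby point outside that set, at the cost of the additive 1. *)
Lemma cont_points_bounded (a t0 t1 : R) (phi : R -> 'rV[R]_n.+1) : 0 < a <= 1 -> t0 < t1 ->
  PCa a t0 t1 phi ->
  exists M : R, forall t, cont_points a t0 t1 phi t -> `|caputo a t0 t1 phi t| <= M.
Proof.
move=> a01 t01 [_ [psi pc phiE]].
have [D [fD Dsub cE _ _]] := caputo_PCa a01 t01 pc phiE.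
have [M hM] := PC_bounded pc; exists (`|caputo_cst a| * M + 1) => t [tI ct].
move/cvgrPdist_lt : ct => /(_ 1 ltr01); rewrite near_withinE => h.
have [s [sI Ds hs]] := exists_near_notin_finite t01 tI fD h.
have {}sI : s \in `[t0, t1].
  by move: sI; rewrite !in_itv/= => /andP[/ltW -> /ltW ->].
have := hs sI; rewrite (cE s sI Ds) => h1.
have -> : caputo a t0 t1 phi t = caputo_cst a *: psi s + (caputo a t0 t1 phi t - caputo_cst a *: psi s).
  by rewrite addrC subrK.
apply: le_trans (ler_normD _ _) _; apply: lerD; last exact: ltW.
by rewrite normrZ; apply: ler_wpM2l => //; exact: hM.
Qed.

Lemma rV_ball_compact (M : R) : compact [set v : 'rV[R]_n.+1 | `|v| <= M].
Proof.
apply: bounded_closed_compact.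
  by exists M; split; [exact: num_real|move=> x Mx v /= /le_trans; apply; exact: ltW].
rewrite (_ : [set _ | _] = (@Num.norm R 'rV[R]_n.+1) @^-1` [set x | x <= M])//.
by apply: preimage_closed => // x _; exact: norm_continuous.
Qed.

Lemma continuous_segment_bounded (t0 t1 : R) (phi : R -> 'rV[R]_n.+1) :
  {within `[t0, t1]%classic, continuous phi} ->
  exists M : R, forall t, t \in `[t0, t1] -> `|phi t| <= M.
Proof.
move=> cphi; apply: (@PC_bounded _ _ t0 t1 phi); exists set0; split => //.
by move=> t tI _; apply: (subspace_continuousP _ _).1 cphi _ _.
Qed.

Lemma closure_graph_compact (a t0 t1 : R) (phi : R -> 'rV[R]_n.+1) : 0 < a <= 1 ->
  t0 < t1 -> PCa a t0 t1 phi -> compact (closure (graph a t0 t1 phi)).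
Proof.
move=> a01 t01 pca; have [M1 h1] := continuous_segment_bounded pca.1.
have [M2 h2] := cont_points_bounded a01 t01 pca.
pose K : set E := (`[t0, t1]%classic `*` [set v | `|v| <= M1]) `*` [set v | `|v| <= M2].
have cK : compact K.
  apply: compact_setX; last exact: rV_ball_compact.
  by apply: compact_setX; [exact: segment_compact|exact: rV_ball_compact].
apply: (subclosed_compact _ cK); first exact: closed_closure.
have clK : closed K by apply: compact_closed => //; exact: norm_hausdorff.
rewrite [X in _ `<=` X](closure_id K).1//; apply: closure_subset => p [t tT <-].
by split; [split => /=; [exact: tT.1|exact/h1/tT.1]|exact: h2].
Qed.

Lemma uniform_graph_neighbourhood (A : set E)
    (L : R -> 'rV[R]_n.+1 -> 'rV[R]_n.+1 -> R) : compact (closure A) ->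
  L_Lx_continuous_near L A ->
  exists r C : R, exists U : set E, [/\ 0 < r, open U,
    forall p, U p -> {for p, continuous (fun q => L q.1.1 q.1.2 q.2)},
    forall p, U p -> differentiable (fun z => L p.1.1 z p.2) p.1.2
    & forall p q, closure A p -> ball p r q ->
      [/\ U q, `|L q.1.1 q.1.2 q.2| <= C & `|grad_x L q.1.1 q.1.2 q.2| <= C]].
Proof.
move=> cA [U [oU AU cL dL cG]].
have := cA => /compact_near_coveringP.
(* One parameter M plays two roles, bound for L and its gradient and inverse of the radius, so a
   single limit at +oo makes all of them uniform. *)
move=> /(_ R +oo%R (fun M p => forall q, ball p M^-1 q ->
  [/\ U q, `|L q.1.1 q.1.2 q.2| <= M & `|grad_x L q.1.1 q.1.2 q.2| <= M])).
case.
- move=> p Ap; have Up := AU _ Ap.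
  have /cvgrPdist_lt /(_ 1 ltr01) nL := cL _ Up.
  have /cvgrPdist_lt /(_ 1 ltr01) nG := cG _ Up.
  have nU : nbhs p U by exact: open_nbhs_nbhs.
  have [d /= d0 hd] := (nbhs_ballP _ _).1 (filterI nU (filterI nL nG)).
  pose M := Num.max (2 / d) (Num.max (`|L p.1.1 p.1.2 p.2| + 1) (`|grad_x L p.1.1 p.1.2 p.2| + 1)).
  have d20 : 0 < 2 / d by rewrite divr_gt0.
  exists (ball p (d / 2), [set m | M <= m]).
    split => /=; first by apply: nbhsx_ballx; rewrite divr_gt0.
    exact: nbhs_pinfty_ge (num_real _).
  move=> [x m] /= [px]; rewrite !ge_max => /and3P[m1 m2 m3] q xq.
  have m0 : 0 < m by exact: lt_le_trans m1.
  have mi : m^-1 <= d / 2 by rewrite -[d / 2]invrK invf_div lef_pV2 ?posrE.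
  have pq : ball p d q.
    by apply: (ball_split px); apply: le_ball xq.
  have [Uq [Lq Gq]] := hd _ pq; split => //.
    apply: le_trans m2; rewrite -[X in `|X|](subKr (L p.1.1 p.1.2 p.2)).
    by apply: le_trans (ler_normB _ _) _; rewrite lerD2l ltW.
  apply: le_trans m3; rewrite -[X in `|X|](subKr (grad_x L p.1.1 p.1.2 p.2)).
  by apply: le_trans (ler_normB _ _) _; rewrite lerD2l ltW.
- move=> M [_ h]; pose m := Num.max (M + 1) 1.
  have m1 : M < m by rewrite lt_max; apply/orP; left; lra.
  have m0 : 0 < m by rewrite lt_max ltr01 orbT.
  exists m^-1, m, U; split => //; first by rewrite invr_gt0.
  by move=> p q Ap pq; exact: (h m m1 p Ap q pq).
Qed.

(** The norm is the max norm, so expanding [v] in the basis costs the factor n + 1. *)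
Lemma derive_along_le (f : 'rV[R]_n.+1 -> R) (w v : 'rV[R]_n.+1) (C : R) :
  differentiable f w -> `|\row_i 'D_(delta_mx 0 i) f w| <= C ->
  `|'d f w v| <= n.+1%:R * C * `|v|.
Proof.
move=> df hC; rewrite [v in 'd f w v]row_sum_delta linear_sum/=.
apply: le_trans (ler_norm_sum _ _ _) _.
have -> : n.+1%:R * C * `|v| = \sum_(i < n.+1) (C * `|v|).
  by rewrite sumr_const card_ord -[in RHS]mulr_natl mulrA.
apply: ler_sum => i _; rewrite linearZ/= normrM mulrC.
apply: ler_pM => //; last exact: le_coord.
by apply: le_trans hC; have := le_coord (\row_i 'D_(delta_mx 0 i) f w) i; rewrite mxE deriveE.
Qed.

(** Mean value theorem along the segment from x to z, which remains in the ball where the gradient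
    is bounded. *)
Lemma lipschitz_near (L : R -> 'rV[R]_n.+1 -> 'rV[R]_n.+1 -> R) (U : set E) (r C : R) (p : E) z :
  (forall p, U p -> differentiable (fun z => L p.1.1 z p.2) p.1.2) ->
  (forall q, ball p r q -> U q /\ `|grad_x L q.1.1 q.1.2 q.2| <= C) ->
  `|z - p.1.2| < r ->
  `|L p.1.1 z p.2 - L p.1.1 p.1.2 p.2| <= n.+1%:R * C * `|z - p.1.2|.
Proof.
move=> dL hb zr; case: p hb zr => -[t x] y /= hb zr.
have r0 : 0 < r by exact: le_lt_trans zr.
pose f z := L t z y; pose g (s : R) : 'rV[R]_n.+1 := x + s *: (z - x).
have inb s : 0 <= s <= 1 -> ball (t, x, y) r (t, g s, y).
  move=> /andP[s0 s1]; split; last exact: ballxx.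
  split; first exact: ballxx.
  rewrite -ball_normE /ball_/= /g opprD addNKr normrN normrZ ger0_norm//.
  by apply: le_lt_trans zr; apply: ler_piMl.
have df s : 0 <= s <= 1 -> differentiable f (g s).
  by move=> s01; have [Uq _] := hb _ (inb s s01); exact: (dL _ Uq).
have dg (s : R) : is_diff s g ( *:%R ^~ (z - x)).
  have h : is_diff s (cst x + ( *:%R ^~ (z - x))) (0 + ( *:%R ^~ (z - x))).
    by apply: is_diffD.
  by move: h; rewrite add0r.
have dfg (s : R) : 0 <= s <= 1 -> is_derive s (1 : R) (f \o g) ('d f (g s) (z - x)).
  move=> s01; have [dgs dgE] := dg s; have dfs := df _ s01.
  have dc : differentiable (f \o g) s by exact: differentiable_comp.
  apply: DeriveDef; first exact: diff_derivable.
  by rewrite deriveE// diff_comp//= dgE scale1r.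
have [||s sI] := @MVT _ (f \o g) (fun s => 'd f (g s) (z - x)) 0 1 ltr01.
- by move=> s; rewrite in_itv/= => /andP[s0 s1]; apply: dfg; rewrite !ltW.
- apply: continuous_in_subspaceT => s; rewrite inE/= in_itv/= => s01.
  have [h _] := dfg s s01.
  exact/differentiable_continuous/derivable1_diffP.
have g0 : g 0 = x by rewrite /g scale0r addr0.
have g1 : g 1 = z by rewrite /g scale1r addrC subrK.
rewrite /= g0 g1 subr0 mulr1 -/(f z) -/(f x) => ->.
have s01 : 0 <= s <= 1 by move: sI; rewrite in_itv/= => /andP[? ?]; rewrite !ltW.
apply: derive_along_le; first exact: df.
by have [_] := hb _ (inb s s01).
Qed.
End graph_neighbourhood.

(** * Fractional integral of the pulse and its estimates *)

Section needle.
Context {R : realType}.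
Notation mu := (@lebesgue_measure R).

(** By homogeneity: the ratios x/(x + y) and y/(x + y) add up to 1, and a ratio in [0, 1] is at most
    its power of exponent p <= 1. *)
Lemma powR_subadditive (p x y : R) : 0 < p <= 1 -> 0 <= x -> 0 <= y ->
  (x + y) `^ p <= x `^ p + y `^ p.
Proof.
move=> /andP[p0 p1] x0 y0.
have [xy0|xy0] := eqVneq (x + y) 0.
  by rewrite xy0 powR0 ?gt_eqF// addr_ge0 ?powR_ge0.
have xy : 0 < x + y by rewrite lt_neqAle eq_sym xy0 addr_ge0.
have H (z : R) : 0 <= z -> z <= x + y -> (x + y) `^ p * (z / (x + y)) <= z `^ p.
  move=> z0 zxy; have [->|z0'] := eqVneq z 0; first by rewrite mul0r mulr0 powR_ge0.
  have zE : z = (x + y) * (z / (x + y)) by rewrite mulrC divfK.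
  have q0 : 0 < z / (x + y) by rewrite divr_gt0// lt_neqAle eq_sym z0'.
  have -> : z `^ p = (x + y) `^ p * (z / (x + y)) `^ p by rewrite -powRM -?zE ?ltW.
  apply: ler_wpM2l; first exact: powR_ge0.
  by apply: ger1_powR => //; rewrite q0 ler_pdivrMr// mul1r.
have e : (x + y) `^ p = (x + y) `^ p * (x / (x + y)) + (x + y) `^ p * (y / (x + y)).
  by rewrite -mulrDr -mulrDl divff// mulr1.
by rewrite e; apply: lerD; apply: H => //; [rewrite lerDl|rewrite lerDr].
Qed.

(** Mean value theorem; the derivative is nonincreasing because p - 1 <= 0. *)
Lemma powR_increment_bounds (p x y : R) : 0 < p <= 1 -> 0 < x -> x <= y ->
  p * (y - x) * y `^ (p - 1) <= y `^ p - x `^ p <= p * (y - x) * x `^ (p - 1).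
Proof.
move=> /andP[p0 p1] x0; rewrite le_eqVlt => /predU1P[->|xy].
  by rewrite !subrr !(mulr0, mul0r) lexx.
have [||c] := @MVT _ (fun z => z `^ p) (fun z => p * z `^ (p - 1)) x y xy.
- by move=> z; rewrite in_itv/= => /andP[xz _]; apply: is_derive1_powR; exact: lt_trans xz.
- apply: continuous_in_subspaceT => z; rewrite inE/= in_itv/= => /andP[xz _].
  have [h _] := is_derive1_powR p (lt_le_trans x0 xz).
  exact/differentiable_continuous/derivable1_diffP.
rewrite in_itv/= => /andP[xc cy] ->.
have yx : 0 < y - x by rewrite subr_gt0.
have H u v : 0 < u -> u <= v -> v `^ (p - 1) <= u `^ (p - 1).
  move=> u0 uv; have v0 : 0 < v by exact: lt_le_trans uv.
  rewrite -[p - 1]opprB !(powRN _ (1 - p)) lef_pV2 ?posrE ?powR_gt0//.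
  by apply: ge0_ler_powR; rewrite ?nnegrE ?subr_ge0// ltW.
have h1 := H _ _ x0 (ltW xc); have h2 := H _ _ (lt_trans x0 xc) (ltW cy).
rewrite ![p * (y - x)]mulrC ![p * _ * (y - x)]mulrC -!mulrA; apply/andP; split;
by do 2 (apply: ler_wpM2l; first exact: ltW).
Qed.

(* [Bt 1 p] is [1 / p]: this is the integral of [s ^ (p - 1)] over [0, x], and 0 for [x <= 0]. *)
Definition qker (p x : R) : R := Bt 1 p * (Num.max 0 x) `^ p.

Lemma qker_le0 p x : 0 < p -> x <= 0 -> qker p x = 0.
Proof. by move=> p0 x0; rewrite /qker max_l// powR0 ?gt_eqF// mulr0. Qed.

Lemma qker_ge0E p x : 0 <= x -> qker p x = Bt 1 p * x `^ p.
Proof. by move=> x0; rewrite /qker max_r. Qed.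

Lemma qker_ge0 p x : 0 < p -> 0 <= qker p x.
Proof. by move=> p0; rewrite mulr_ge0 ?powR_ge0// ltW// Bt_gt0. Qed.

Lemma qker_homo p x y : 0 < p -> x <= y -> qker p x <= qker p y.
Proof.
move=> p0 xy; rewrite /qker ler_wpM2l ?(ltW (Bt_gt0 _ _))//.
have m0 z : 0 <= Num.max 0 z :> R by rewrite le_max lexx.
apply: ge0_ler_powR; rewrite ?nnegrE ?m0 ?(ltW p0)//.
by rewrite ge_max m0 le_max xy orbT.
Qed.

Lemma qker_subadditive p x y : 0 < p <= 1 -> 0 <= y -> qker p (x + y) <= qker p x + qker p y.
Proof.
move=> p01 y0; have /andP[p0 p1] := p01.
have [x0|x0] := leP 0 x.
  rewrite !qker_ge0E ?addr_ge0// -mulrDr ler_wpM2l ?(ltW (Bt_gt0 _ _))//.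
  exact: powR_subadditive.
rewrite (@qker_le0 p x)// ?add0r; last exact: ltW.
by apply: qker_homo => //; rewrite gerDr ltW.
Qed.

Lemma qker_small (p e : R) : 0 < p -> 0 < e ->
  exists2 d : R, 0 < d & forall x, x < d -> qker p x < e.
Proof.
move=> p0 e0; have B0 := @Bt_gt0 R 1 p ltr01 p0.
pose c := e / Bt 1 p; have c0 : 0 < c by rewrite divr_gt0.
have cE : c = (c `^ p^-1) `^ p by rewrite -powRrM mulVf ?powRr1 ?gt_eqF ?ltW.
exists (c `^ p^-1); first by rewrite powR_gt0.
move=> x xd; rewrite /qker mulrC -ltr_pdivlMr// -/c cE.
apply: gt0_ltr_powR => //; rewrite ?nnegrE ?powR_ge0//.
  by rewrite le_max lexx.
by rewrite gt_max powR_gt0.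
Qed.

(** Being monotone and subadditive, [qker p] is its own modulus of continuity. *)
Lemma qker_continuous p : 0 < p <= 1 -> continuous (qker p).
Proof.
move=> p01 x; have /andP[p0 p1] := p01.
apply/cvgrPdist_lt => e e0; have [d d0 hd] := qker_small p0 e0.
apply/nbhs_ballP; exists d => //= y xy.
have H u v : u <= v -> v - u < d -> `|qker p v - qker p u| < e.
  move=> uv vud; rewrite ger0_norm ?subr_ge0 ?qker_homo//.
  apply: le_lt_trans (hd _ vud); rewrite lerBlDl.
  by have := @qker_subadditive p u (v - u) p01; rewrite subr_ge0 addrC subrK; apply.
have [xy'|yx] := leP x y.
  by rewrite distrC; apply: H => //; apply: le_lt_trans xy; rewrite distrC ler_norm.
by apply: H; [exact: ltW|apply: le_lt_trans xy; rewrite ler_norm].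
Qed.

Lemma measurable_step (u : R) (A : set R) : measurable A ->
  measurable_fun A (fun s : R => (u <= s)%R%:R : R).
Proof.
move=> mA; have -> : (fun s : R => (u <= s)%R%:R : R) = \1_(`[u, +oo[%classic : set R).
  by apply/funext => s; rewrite indicE in_set_itv in_itv/= andbT.
exact: measurable_indic.
Qed.

Lemma kernel_step_integrable (p t0 u t : R) : 0 < p ->
  mu.-integrable `[t0, t] (EFin \o (fun s => (t - s) `^ (p - 1) * (u <= s)%R%:R)).
Proof.
move=> p0; apply: (@kernel_mul_integrable _ _ _ _ 1) => //; first exact: measurable_step.
by move=> s _; case: (u <= s); rewrite ?normr1 ?normr0.
Qed.

(** Fractional integral of a Heaviside step. Extending [qker] by 0 lets one formula serve before and
    after the step. *)
Lemma Rintegral_kernel_step (p t0 u t : R) : 0 < p -> t0 <= u ->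
  \int[mu]_(s in `[t0, t]) ((t - s) `^ (p - 1) * (u <= s)%R%:R) = qker p (t - u).
Proof.
move=> p0 t0u; have [ut|tu] := ltP u t; last first.
  rewrite qker_le0 ?subr_le0// -Rintegral_itv_bndo_bndc; last first.
    apply: integrableS (kernel_step_integrable t0 u t p0) => //.
    by move=> s /=; rewrite !in_itv/= => /andP[-> /ltW].
  rewrite (@eq_Rintegral _ _ _ mu _ (fun=> 0)); last first.
    move=> s; rewrite inE/= in_itv/= => /andP[_ st].
    by rewrite leNgt (lt_le_trans st tu) mulr0.
  by rewrite Rintegral_cst// mul0r.
rewrite qker_ge0E ?subr_ge0 ?ltW//.
have -> : Bt 1 p * (t - u) `^ p = \int[mu]_(s in `[u, t]) (bker 1 p u t s).
  by rewrite Rintegral_bker// mulrC addrAC subrr add0r.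
have -> : `[u, t]%classic = (`[t0, t]%classic `&` `[u, +oo[%classic : set R).
  apply/seteqP; split => s /=; rewrite !in_itv/= andbT.
    by move=> /andP[us ->]; rewrite us (le_trans t0u us).
  by move=> [/andP[_ ->] ->].
rewrite Rintegral_mkcondr; apply: eq_Rintegral => s _; rewrite patchE in_set_itv in_itv/= andbT.
by case: ifPn => us; rewrite ?mulr0// /bker subrr powRr0.
Qed.

(* [Gamma p] times the fractional integral of order [p] of the scalar [pulse] below. *)
Definition needle (p tau tau1 tau2 k t : R) : R :=
  qker p (t - tau) - (1 + k) * qker p (t - tau1) + k * qker p (t - tau2).

Lemma qker_increment_bounds (p x y : R) : 0 < p <= 1 -> 0 < x -> x <= y ->
  p * Bt 1 p * (y - x) * y `^ (p - 1) <= qker p y - qker p x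
    <= p * Bt 1 p * (y - x) * x `^ (p - 1).
Proof.
move=> p01 x0 xy; have /andP[p0 p1] := p01.
have B0 := ltW (@Bt_gt0 R 1 p ltr01 p0).
rewrite !qker_ge0E ?(ltW x0) ?(le_trans (ltW x0) xy)// -mulrBr.
have /andP[h1 h2] := powR_increment_bounds p01 x0 xy.
rewrite ![p * Bt 1 p]mulrC -!mulrA; apply/andP; split; apply: ler_wpM2l => //.
  by rewrite mulrA.
by rewrite [leRHS]mulrA.
Qed.

Lemma needle_le0 (p tau tau1 tau2 k t : R) : 0 < p -> tau <= tau1 -> tau1 <= tau2 ->
  t <= tau -> needle p tau tau1 tau2 k t = 0.
Proof.
move=> p0 h1 h2 h3; rewrite /needle !qker_le0 ?subr_le0//; first by ring.
  by rewrite (le_trans h3)// (le_trans h1).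
by rewrite (le_trans h3).
Qed.

Lemma needle_continuous (p tau tau1 tau2 k : R) : 0 < p <= 1 ->
  continuous (needle p tau tau1 tau2 k).
Proof.
move=> p01 t; have H (c : R) : (fun t => qker p (t - c)) @ t --> qker p (t - c).
  have : {for t, continuous (qker p \o (fun t => t - c))}.
    apply: continuous_comp; last exact: qker_continuous.
    by apply: cvgB; [exact: cvg_id|exact: cvg_cst].
  by [].
by apply: cvgD; [apply: cvgB => //; apply: cvgM => //; exact: cvg_cst|apply: cvgM => //; exact: cvg_cst].
Qed.

(** The needle is the increment of [qker] over the first part minus k times the increment over the
    second; subadditivity puts them in [0, qker p a] and [0, qker p b]. *)
Lemma needle_norm_le (p tau a b k t : R) : 0 < p <= 1 -> 0 <= a -> 0 <= b -> 0 <= k ->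
  `|needle p tau (tau + a) (tau + a + b) k t| <= qker p a + k * qker p b.
Proof.
move=> p01 a0 b0 k0; have /andP[p0 p1] := p01.
have s1 := @qker_subadditive p (t - (tau + a)) a p01 a0.
have s2 := @qker_subadditive p (t - (tau + a + b)) b p01 b0.
have e1 : t - (tau + a) + a = t - tau by ring.
have e2 : t - (tau + a + b) + b = t - (tau + a) by ring.
rewrite e1 in s1; rewrite e2 in s2.
have m1 : qker p (t - (tau + a)) <= qker p (t - tau) by apply: qker_homo => //; lra.
have m2 : qker p (t - (tau + a + b)) <= qker p (t - (tau + a)) by apply: qker_homo => //; lra.
have qa := qker_ge0 a p0; have qb := qker_ge0 b p0.
rewrite /needle ler_norml.
move: (qker p (t - tau)) (qker p (t - (tau + a))) (qker p (t - (tau + a + b))) s1 s2 m1 m2.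
by move=> x y z s1 s2 m1 m2; apply/andP; split; nra.
Qed.

(* Both bounds on [k] hold for the ratio of the increments of [qker p (t1 - _)] over the two parts
   of the pulse, which is the [k] making the needle vanish at [t1].  Against [(t1 - t) ^ (be - 1)]
   the majorant integrates to Beta functions. *)
Lemma needle_tail_le (p t1 tau a b k t : R) : 0 < p <= 1 -> 0 < a -> 0 < b ->
  0 <= k -> k <= a / b -> a / b * ((t1 - tau) `^ (p - 1) / (t1 - (tau + a + b)) `^ (p - 1)) <= k ->
  tau + a + b < t -> t <= t1 ->
  `|needle p tau (tau + a) (tau + a + b) k t| <= p * Bt 1 p * a *
    ((2 - (t1 - tau) `^ (p - 1) / (t1 - (tau + a + b)) `^ (p - 1)) *
      (t - (tau + a + b)) `^ (p - 1) - (t - tau) `^ (p - 1)).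
Proof.
move=> p01 a0 b0 k0 kab kr tt tt1; have /andP[p0 p1] := p01.
set r := (t1 - tau) `^ (p - 1) / _ in kr *.
have pB : 0 < p * Bt 1 p by rewrite mulr_gt0// Bt_gt0.
have [] : 0 < t - (tau + a) /\ t - (tau + a) <= t - tau by split; lra.
move=> x1 x2; have /andP[l1 u1] := qker_increment_bounds p01 x1 x2.
have [] : 0 < t - (tau + a + b) /\ t - (tau + a + b) <= t - (tau + a) by split; lra.
move=> y1 y2; have /andP[l2 u2] := qker_increment_bounds p01 y1 y2.
have e1 : t - tau - (t - (tau + a)) = a by ring.
have e2 : t - (tau + a) - (t - (tau + a + b)) = b by ring.
rewrite e1 in l1 u1; rewrite e2 in l2 u2.
have mono u v : 0 < u -> u <= v -> v `^ (p - 1) <= u `^ (p - 1).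
  move=> u0 uv; have v0 : 0 < v by exact: lt_le_trans uv.
  rewrite -[p - 1]opprB !(powRN _ (1 - p)) lef_pV2 ?posrE ?powR_gt0//.
  by apply: ge0_ler_powR; rewrite ?nnegrE ?subr_ge0// ltW.
have m2 := mono _ _ y1 y2; have m1 := mono _ _ x1 x2.
have z0 := powR_ge0 (t - tau) (p - 1).
have r0 : 0 <= r by rewrite divr_ge0 ?powR_ge0.
have r1 : r <= 1.
  rewrite ler_pdivrMr; last by apply: powR_gt0; lra.
  by rewrite mul1r; apply: mono; lra.
have kbE : k * b <= a by rewrite -ler_pdivlMr.
have krE : a * r <= k * b.
  by move: kr; rewrite -[a / b * r]mulrAC ler_pdivrMr.
rewrite /needle; move: (qker p (t - tau)) (qker p (t - (tau + a))) (qker p (t - (tau + a + b))) l1 u1 l2 u2.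
move: ((t - tau) `^ (p - 1)) ((t - (tau + a)) `^ (p - 1)) ((t - (tau + a + b)) `^ (p - 1)) m1 m2 z0.
move=> z x y m1 m2 z0 q0 q1 q2 l1 u1 l2 u2.
move: (p * Bt 1 p) pB l1 u1 l2 u2 => c c0 l1 u1 l2 u2.
(* With z <= x <= y the three kernel values, the increments lie in [c a z, c a x] and
   [c b x, c b y], and k b in [a r, a]. So the needle is at most c a (1 - r) x and at least c a (z -
   y); both are controlled by (2 - r) y - z = (1 - r) y + (y - z). *)
have -> : q0 - (1 + k) * q1 + k * q2 = (q0 - q1) - k * (q1 - q2) by ring.
have kl2 := ler_wpM2l k0 l2; have ku2 := ler_wpM2l k0 u2.
have ca : 0 <= c * a by rewrite mulr_ge0 ?ltW.
have y0 : 0 <= y by apply: le_trans m2; apply: le_trans m1.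
have yx : 0 <= x by apply: le_trans m1.
have cx : 0 <= c * x by rewrite mulr_ge0// ltW.
have cy : 0 <= c * y by rewrite mulr_ge0// ltW.
have s1 : c * x * (a * r) <= c * x * (k * b) by exact: ler_wpM2l.
have s2 : c * y * (k * b) <= c * y * a by exact: ler_wpM2l.
have s3 : c * a * (1 - r) * x <= c * a * (1 - r) * y.
  by apply: ler_wpM2l => //; rewrite mulr_ge0// subr_ge0.
have s4 : c * a * z <= c * a * y by apply: ler_wpM2l => //; apply: le_trans m2.
have s5 : 0 <= c * a * (1 - r) * y by apply: mulr_ge0 => //; apply: mulr_ge0; rewrite ?subr_ge0.
rewrite ler_norml; apply/andP; split.
  have : k * (c * b * y) = c * y * (k * b) by ring.
  have : c * a * ((2 - r) * y - z) = c * a * (1 - r) * y + c * y * a - c * a * z by ring.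
  lra.
have : k * (c * b * x) = c * x * (k * b) by ring.
have : c * a * ((2 - r) * y - z) = c * a * (1 - r) * y + c * a * y - c * a * z by ring.
have : c * a * (1 - r) * x = c * a * x - c * x * (a * r) by ring.
lra.
Qed.

(** The kernel started at [tau] is integrated over all of [tau, t1] and the part over the pulse is
    taken off again. What is left are two complete Beta integrals and one integral over a shrinking
    interval. *)
Lemma needle_tail_integral (p be t1 tau a b k : R) : 0 < p <= 1 -> 0 < be -> 0 < a -> 0 < b ->
  0 <= k -> k <= a / b -> a / b * ((t1 - tau) `^ (p - 1) / (t1 - (tau + a + b)) `^ (p - 1)) <= k ->
  tau + a + b < t1 ->
  \int[mu]_(t in `]tau + a + b, t1]) ((t1 - t) `^ (be - 1) *
      `|needle p tau (tau + a) (tau + a + b) k t|) <=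
  p * Bt 1 p * a * ((2 - (t1 - tau) `^ (p - 1) / (t1 - (tau + a + b)) `^ (p - 1)) *
    ((t1 - (tau + a + b)) `^ (p + be - 1) * Bt p be) -
    ((t1 - tau) `^ (p + be - 1) * Bt p be -
     \int[mu]_(t in `[tau, tau + a + b]) bker p be tau t1 t)).
Proof.
move=> p01 be0 a0 b0 k0 kab kr tt1; have /andP[p0 p1] := p01.
set r := (t1 - tau) `^ (p - 1) / _ in kr *.
pose Y := needle p tau (tau + a) (tau + a + b) k.
have tau2 : tau < tau + a + b by lra.
have sub (u : R) : tau <= u -> `]u, t1]%classic `<=` `[tau, t1]%classic.
  by move=> tu x /=; rewrite !in_itv/= => /andP[/ltW/(le_trans tu) -> ->].
have i1 : mu.-integrable `]tau + a + b, t1] (EFin \o bker p be tau t1).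
  by apply: integrableS (bker_integrable tau t1 p0 be0) => //; apply: sub; exact: ltW.
have i2 : mu.-integrable `]tau + a + b, t1] (EFin \o bker p be (tau + a + b) t1).
  apply: integrableS (bker_integrable (tau + a + b) t1 p0 be0) => //.
  by move=> x /=; rewrite !in_itv/= => /andP[/ltW -> ->].
have e2 : \int[mu]_(t in `]tau + a + b, t1]) bker p be (tau + a + b) t1 t =
    (t1 - (tau + a + b)) `^ (p + be - 1) * Bt p be.
  by rewrite Rintegral_itv_obnd_cbnd// Rintegral_bker.
have e1 : \int[mu]_(t in `]tau + a + b, t1]) bker p be tau t1 t =
    (t1 - tau) `^ (p + be - 1) * Bt p be -
     \int[mu]_(t in `[tau, tau + a + b]) bker p be tau t1 t.
  rewrite -(Rintegral_bker p0 be0); last lra.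
  rewrite Rintegral_itvB ?bnd_simp//; first exact: bker_integrable.
    exact: ltW.
  exact: ltW.
have i3 : mu.-integrable `]tau + a + b, t1] (EFin \o (fun t => (2 - r) * bker p be (tau + a + b) t1 t)).
  by apply: eq_integrable (integrableZl _ (2 - r) i2).
have i4 : mu.-integrable `]tau + a + b, t1]
    (EFin \o (fun t => (2 - r) * bker p be (tau + a + b) t1 t - bker p be tau t1 t)).
  by apply: eq_integrable (integrableB _ i3 i1).
have E3 : \int[mu]_(t in `]tau + a + b, t1])
     (p * Bt 1 p * a * ((2 - r) * bker p be (tau + a + b) t1 t - bker p be tau t1 t)) =
   p * Bt 1 p * a * ((2 - r) * \int[mu]_(t in `]tau + a + b, t1]) bker p be (tau + a + b) t1 t -
     \int[mu]_(t in `]tau + a + b, t1]) bker p be tau t1 t).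
  by rewrite RintegralZl// RintegralB// RintegralZl.
rewrite -e2 -e1 -E3.
apply: le_Rintegral => //.
- apply: (@integrableS _ _ _ mu `[tau, t1]) => //; first by apply: sub; exact: ltW.
  apply: (@kernel_mul_integrable _ _ _ _ (qker p a + k * qker p b)) => //.
    apply: measurableT_comp => //; apply: measurable_funTS.
    by apply: continuous_measurable_fun; exact: needle_continuous.
  by move=> t _; rewrite normr_id; apply: needle_norm_le; rewrite // ltW.
- by apply: eq_integrable (integrableZl _ (p * Bt 1 p * a) i4).
move=> t; rewrite /= in_itv/= => /andP[t2 tt].
rewrite /bker.
have -> : p * Bt 1 p * a * ((2 - r) * ((t1 - t) `^ (be - 1) * (t - (tau + a + b)) `^ (p - 1)) -
   (t1 - t) `^ (be - 1) * (t - tau) `^ (p - 1)) =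
  (t1 - t) `^ (be - 1) * (p * Bt 1 p * a * ((2 - r) * (t - (tau + a + b)) `^ (p - 1) - (t - tau) `^ (p - 1))).
  by ring.
apply: ler_wpM2l; first exact: powR_ge0.
exact: needle_tail_le.
Qed.

(** All smallness requirements are met by one choice of h, with the same [e]: length of the pulse,
    distance of k from a/b, supremum of the needle, and its weighted tail relative to h. *)
Lemma needle_exists (p be t1 tau a b e : R) : 0 < p <= 1 -> 0 < be -> tau < t1 ->
  0 < a -> 0 < b -> 0 < e ->
  exists h k : R, let tau1 := tau + a * h in let tau2 := tau1 + b * h in
  [/\ [/\ 0 < h, tau2 < t1, a * h + b * h < e & [/\ 0 <= k, k <= a / b & a / b - k < e]],
   needle p tau tau1 tau2 k t1 = 0,
   (forall t, `|needle p tau tau1 tau2 k t| <= e) &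
   \int[mu]_(t in `]tau2, t1]) ((t1 - t) `^ (be - 1) * `|needle p tau tau1 tau2 k t|) <= e * h].
Proof.
move=> p01 be0 tt1 a0 b0 e0; have /andP[p0 p1] := p01.
pose T := t1 - tau; have T0 : 0 < T by rewrite subr_gt0.
pose g := p + be - 1; pose B := Bt p be; have B0 : 0 < B by exact: Bt_gt0.
pose c := p * Bt 1 p * a; have c0 : 0 < c by rewrite !mulr_gt0// Bt_gt0.
have ab0 : 0 < a / b by rewrite divr_gt0.
pose u (s : R) := (T - s) `^ g.
have cu : u s @[s --> (0 : R)] --> u 0.
  have : {for (0 : R), continuous ((fun x => x `^ g) \o (fun s => T - s))}.
    apply: continuous_comp; first by apply: cvgB; [exact: cvg_cst|exact: cvg_id].
    rewrite subr0; have [h _] := is_derive1_powR g T0.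
    exact/differentiable_continuous/derivable1_diffP.
  by [].
(* [u s * B] is the complete Beta integral started at tau + s. The first term will bound the excess
   1 - r through 1 - r <= s/T; the second is the gap between the Beta integrals. Continuity at 0
   uses T > 0 only, so g may be negative. *)
have cF : (s / T * u s * B + (u s - u 0) * B) @[s --> (0 : R)] --> 0 / T * u 0 * B + (u 0 - u 0) * B.
  apply: cvgD; apply: cvgM; (try exact: cvg_cst).
    by apply: cvgM => //; apply: cvgM; [exact: cvg_id|exact: cvg_cst].
  by apply: cvgB => //; exact: cvg_cst.
rewrite subrr !mul0r addr0 in cF.
have ec : 0 < e / c / 2 by rewrite !divr_gt0.
move/cvgrPdist_lt : (cF) => /(_ _ ec) /nbhs_ballP[d1 /= d10 hd1].
have := @parameterized_integral_near_left R tau t1 (e / c / 2) _ tt1 ec (bker_integrable tau t1 p0 be0).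
move=> /nbhs_ballP[d2 /= d20 hd2].
have e4 : 0 < e / (1 + a / b) by rewrite divr_gt0// addr_gt0.
have [d3 d30 hd3] := qker_small p0 e4.
have e5 : 0 < e / (a / b) * T by rewrite mulr_gt0// divr_gt0.
(* The length s = m/2 of the pulse is below every entry: T keeps tau2 before t1, d1 serves the Beta
   gap, d2 the Beta integral over the pulse, d3 the supremum, and the last entry gives a/b - k <
   e. *)
pose m := Num.min T (Num.min e (Num.min d1 (Num.min d2 (Num.min d3 (e / (a / b) * T))))).
have m0 : 0 < m by rewrite !lt_min T0 e0 d10 d20 d30.
pose h := m / 2 / (a + b).
have h0 : 0 < h by rewrite !divr_gt0// addr_gt0.
have sE : a * h + b * h = m / 2 by rewrite -mulrDl /h mulrC divfK// gt_eqF// addr_gt0.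
have ah0 : 0 < a * h by rewrite mulr_gt0.
have bh0 : 0 < b * h by rewrite mulr_gt0.
have : m <= m by []; rewrite {2}/m !le_min => /andP[mT /andP[me /andP[md1 /andP[md2 /andP[md3 mr]]]]].
pose s := a * h + b * h; have s0 : 0 < s by rewrite addr_gt0.
have sm : s < m by rewrite /s sE; lra.
have t2 : tau + a * h + b * h < t1 by move: sm mT; rewrite /s /T; lra.
pose A1 := qker p (t1 - tau) - qker p (t1 - (tau + a * h)).
pose A2 := qker p (t1 - (tau + a * h)) - qker p (t1 - (tau + a * h + b * h)).
have [] : 0 < t1 - (tau + a * h) /\ t1 - (tau + a * h) <= t1 - tau by split; lra.
move=> x1 x2; have /andP[l1 u1] := qker_increment_bounds p01 x1 x2.
have [] : 0 < t1 - (tau + a * h + b * h) /\ t1 - (tau + a * h + b * h) <= t1 - (tau + a * h) by split; lra.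
move=> y1 y2; have /andP[l2 u2] := qker_increment_bounds p01 y1 y2.
have E1 : t1 - tau - (t1 - (tau + a * h)) = a * h by ring.
have E2 : t1 - (tau + a * h) - (t1 - (tau + a * h + b * h)) = b * h by ring.
rewrite E1 -/A1 in l1 u1; rewrite E2 -/A2 in l2 u2.
have pB : 0 < p * Bt 1 p by rewrite mulr_gt0// Bt_gt0.
pose X0 := (t1 - tau) `^ (p - 1); pose X1 := (t1 - (tau + a * h)) `^ (p - 1).
pose X2 := (t1 - (tau + a * h + b * h)) `^ (p - 1).
rewrite -/X0 -/X1 in l1 u1; rewrite -/X1 -/X2 in l2 u2.
have X00 : 0 < X0 by rewrite powR_gt0. have X10 : 0 < X1 by rewrite powR_gt0.
have X20 : 0 < X2 by rewrite powR_gt0.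
have A20 : 0 < A2 by apply: lt_le_trans l2; apply: mulr_gt0 => //; exact: mulr_gt0.
pose k := A1 / A2.
have A10 : 0 < A1 by apply: lt_le_trans l1; apply: mulr_gt0 => //; exact: mulr_gt0.
have k0 : 0 <= k by rewrite divr_ge0 ?ltW.
(* The upper bound of A1 and the lower bound of A2 share the kernel value X1 at the switching point,
   which cancels. *)
have kab : k <= a / b.
  rewrite /k ler_pdivrMr// mulrAC ler_pdivlMr//.
  apply: le_trans (ler_wpM2r (ltW b0) u1) _; apply: le_trans (ler_wpM2l (ltW a0) l2).
  by rewrite le_eqVlt; apply/orP; left; apply/eqP; ring.
have kr : a / b * (X0 / X2) <= k.
  rewrite /k ler_pdivlMr//.
  apply: le_trans (ler_wpM2l _ u2) _; first by rewrite mulr_ge0 ?divr_ge0 ?ltW.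
  apply: le_trans l1; rewrite le_eqVlt; apply/orP; left; apply/eqP.
  by field; rewrite !gt_eqF.
(* X0 / X2 is ((T - s)/T) to the power 1 - p, hence at least (T - s)/T. *)
have r1 : 1 - X0 / X2 <= s / T.
  have q01 : 0 < (t1 - (tau + a * h + b * h)) / (t1 - tau) <= 1.
    by rewrite divr_gt0// ler_pdivrMr// mul1r; lra.
  have : (t1 - (tau + a * h + b * h)) / (t1 - tau) <=
      ((t1 - (tau + a * h + b * h)) / (t1 - tau)) `^ (1 - p) by apply: ger1_powR => //; lra.
  rewrite powRM ?invr_ge0 ?(ltW y1) ?(ltW T0)//.
  have -> : (t1 - tau)^-1 `^ (1 - p) = X0.
    by rewrite -powR_inv1 ?(ltW T0)// -powRrM mulN1r opprB.
  have -> : (t1 - (tau + a * h + b * h)) `^ (1 - p) = X2^-1 by rewrite /X2 -powRN opprB.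
  rewrite [_^-1 * X0]mulrC -/T => H; rewrite lerBlDl -lerBlDr; apply: le_trans H.
  rewrite le_eqVlt; apply/orP; left; apply/eqP; rewrite /s /T; field.
  by rewrite gt_eqF.
have sme : s < e by exact: lt_le_trans sm me.
have ake : a / b - k < e.
  have : a / b * (1 - X0 / X2) < e.
    apply: le_lt_trans (ler_wpM2l (ltW ab0) r1) _.
    rewrite -ltr_pdivlMl// ltr_pdivrMr//.
    by rewrite [_^-1 * e]mulrC; exact: lt_le_trans sm mr.
  by move: kr; rewrite mulrBr mulr1; lra.
exists h, k; split => //.
- rewrite /needle; have : A1 - k * A2 = 0 by rewrite /k divfK ?subrr// gt_eqF.
  by rewrite /A1 /A2 => H; rewrite -[RHS]H; ring.
- move=> t; apply: le_trans (needle_norm_le _ _ _ _ _ _) _ => //; try exact: ltW.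
  have q1 := hd3 (a * h); have q2 := hd3 (b * h).
  have {}q1 : qker p (a * h) < e / (1 + a / b) by apply: q1; move: sm md3; rewrite /s; lra.
  have {}q2 : qker p (b * h) < e / (1 + a / b) by apply: q2; move: sm md3; rewrite /s; lra.
  have -> : e = e / (1 + a / b) + a / b * (e / (1 + a / b)).
    by field; rewrite !gt_eqF// addr_gt0.
  apply: lerD; first exact: ltW.
  by apply: ler_pM => //; [exact: qker_ge0|exact: ltW].
have abh : a * h / (b * h) = a / b by field; rewrite !gt_eqF.
have ih := @needle_tail_integral p be t1 tau (a * h) (b * h) k p01 be0 ah0 bh0 k0.
rewrite abh in ih; apply: le_trans (ih kab kr t2) _.
rewrite -/X0 -/X2 -/T -/g -/B.
have -> : t1 - (tau + a * h + b * h) = T - s by rewrite /T /s; ring.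
have uE : T `^ g = u 0 by rewrite /u subr0.
rewrite uE -/(u s).
have F1 : s / T * u s * B + (u s - u 0) * B < e / c / 2.
  have := hd1 s; rewrite /ball/= sub0r normrN gtr0_norm// sub0r normrN => H.
  by apply: le_lt_trans (H _); [exact: ler_norm|exact: lt_le_trans sm md1].
have F2 : \int[mu]_(t in `[tau, tau + a * h + b * h]) bker p be tau t1 t < e / c / 2.
  have := hd2 (tau + a * h + b * h); rewrite /parameterized_integral => H.
  apply: le_lt_trans (ler_norm _) (H _ _); last lra.
  rewrite /ball/= -addrA opprD addNKr normrN -/s gtr0_norm//; exact: lt_le_trans sm md2.
move: (Rintegral _ _ _) F2 => I F2.
have u0 : 0 <= u s by exact: powR_ge0.
have F3 : (1 - X0 / X2) * (u s * B) <= s / T * (u s * B).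
  by apply: ler_wpM2r => //; rewrite mulr_ge0// ltW.
have F4 : (2 - X0 / X2) * (u s * B) - (u 0 * B - I) <= e / c.
  have -> : (2 - X0 / X2) * (u s * B) = (1 - X0 / X2) * (u s * B) + u s * B by ring.
  have : s / T * u s * B + (u s - u 0) * B = s / T * (u s * B) + u s * B - u 0 * B by ring.
  lra.
have -> : p * Bt 1 p * (a * h) = c * h by rewrite /c; ring.
apply: le_trans (ler_wpM2l _ F4) _; first by rewrite mulr_ge0 ?ltW.
rewrite le_eqVlt; apply/orP; left; apply/eqP; field; rewrite gt_eqF//.
Qed.
End needle.

(** * The perturbed trajectory and its distances to [xo] *)

Section variation.
Context {R : realType} {n : nat}.
Notation mu := (@lebesgue_measure R).
Implicit Types (f g psi : R -> 'rV[R]_n.+1).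

(** For sums: a jump of one summand may be a continuity point of the other, so limits are needed at
    every interior point. *)
Lemma PC_sided_limits (t0 t1 t : R) psi : PC t0 t1 psi -> t \in `]t0, t1[ ->
  cvg (psi @ t^'-) /\ cvg (psi @ t^'+).
Proof.
move=> [D [fD Dsub cD lD]] tI; have [/lD//|Dt] := pselect (D t).
have tI' : t \in `[t0, t1] by move: tI; rewrite !in_itv/= => /andP[/ltW -> /ltW ->].
have nI : nbhs t `[t0, t1]%classic.
  by apply: filterS (near_in_itvoo tI) => s /=; rewrite !in_itv/= => /andP[/ltW -> /ltW ->].
have c : psi s @[s --> t] --> psi t.
  apply: cvg_trans (cD t tI' Dt); apply: cvg_app => P; rewrite /within /= => h.
  by apply: filterS2 nI h => s sI; apply.
by split; apply/cvg_ex; exists (psi t); [exact: cvg_at_left_filter|exact: cvg_at_right_filter].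
Qed.

Lemma PC_add (t0 t1 : R) f g : PC t0 t1 f -> PC t0 t1 g -> PC t0 t1 (fun s => f s + g s).
Proof.
move=> pf pg; have [Df [fDf sDf cDf _]] := pf; have [Dg [fDg sDg cDg _]] := pg.
exists (Df `|` Dg); split.
- by rewrite finite_setU.
- by move=> t [/sDf|/sDg].
- move=> t tI /not_orP[nf ng]; apply: cvgD; [exact: cDf|exact: cDg].
- move=> t Dt; have tI : t \in `]t0, t1[ by case: Dt => [/sDf|/sDg].
  have [lf rf] := PC_sided_limits pf tI; have [lg rg] := PC_sided_limits pg tI.
  by split; [exact: is_cvgD lf lg|exact: is_cvgD rf rg].
Qed.

Lemma PC_step (t0 t1 u : R) (v : 'rV[R]_n.+1) : u \in `]t0, t1[ ->
  PC t0 t1 (fun s => (u <= s)%R%:R *: v).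
Proof.
move=> uI.
have lt_cvg (t : R) (F : set_system R) : Filter F -> (\forall s \near F, (u <= s) = (u <= t)) ->
    (u <= s)%R%:R *: v @[s --> F] --> (u <= t)%R%:R *: v.
  move=> FF h; apply: cvg_near_cst; apply: filterS h => s ->; exact.
exists [set u]; split.
- exact: finite_set1.
- by move=> _ ->.
- move=> t tI /eqP tu; apply: (@lt_cvg t) => /=.
  apply: cvg_within; case: (ltgtP u t) tu => // ut _.
    by apply: filterS (lt_nbhsr ut) => s us; rewrite !ltW.
  by apply: filterS (lt_nbhsl ut) => s us; rewrite leNgt us.
- move=> _ ->; split; apply/cvg_ex.
    exists 0; apply: cvg_near_cst; near=> s; rewrite leNgt.
    have -> : s < u by near: s; exact: nbhs_left_lt.
    by rewrite scale0r.
  exists v; apply: cvg_near_cst; near=> s.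
  have -> : u <= s by near: s; exact: nbhs_right_ge.
  by rewrite scale1r.
Unshelve. all: by end_near. Qed.

Lemma frac_intD (a t0 t1 t : R) f g : 0 < a -> PC t0 t1 f -> PC t0 t1 g -> t \in `[t0, t1] ->
  frac_int a t0 (fun s => f s + g s) t = frac_int a t0 f t + frac_int a t0 g t.
Proof.
move=> a0 pf pg tI; apply/rowP => i; rewrite !mxE -mulrDr.
have sub : `[t0, t]%classic `<=` `[t0, t1]%classic.
  move: tI; rewrite in_itv/= => /andP[_ tt1].
  by move=> x/=; rewrite !in_itv/= => /andP[-> xu]; apply: le_trans tt1.
have ki psi : PC t0 t1 psi ->
    mu.-integrable `[t0, t] (EFin \o (fun s => (t - s) `^ (a - 1) * psi s 0 i)).
  move=> pp; have [M hM] := PC_coord_bounded pp.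
  apply: (@kernel_mul_integrable _ _ _ _ M) => //.
    exact: measurable_funS (PC_measurable i pp).
  by move=> s /sub; exact: hM.
rewrite -RintegralD//; [|exact: ki|exact: ki].
by congr (_ * _); apply: eq_Rintegral => s _; rewrite !mxE mulrDr.
Qed.

Lemma frac_int_step (a t0 u t : R) (v : 'rV[R]_n.+1) : 0 < a -> t0 <= u ->
  frac_int a t0 (fun s => (u <= s)%R%:R *: v) t = ((Gamma a)^-1 * qker a (t - u)) *: v.
Proof.
move=> a0 t0u; apply/rowP => i; rewrite !mxE -(@Rintegral_kernel_step _ _ t0)//.
rewrite -mulrA; congr (_ * _); rewrite -RintegralZr//; last exact: kernel_step_integrable.
by apply: eq_Rintegral => s _; rewrite mxE mulrA.
Qed.

(** Written with Heaviside steps, so that its fractional integral is by linearity a combination of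
    translates of [qker]. *)
Definition pulse (tau tau1 tau2 k t : R) : R :=
  (tau <= t)%R%:R - (1 + k) * (tau1 <= t)%R%:R + k * (tau2 <= t)%R%:R.

Lemma pulseE (tau tau1 tau2 k : R) (v : 'rV[R]_n.+1) :
  (fun t => pulse tau tau1 tau2 k t *: v) =
  (fun t => (tau <= t)%R%:R *: v + (tau1 <= t)%R%:R *: (- (1 + k) *: v) +
    (tau2 <= t)%R%:R *: (k *: v)).
Proof.
apply/funext => t; rewrite /pulse !scalerDl !scalerA.
congr (_ + _ *: v + _ *: v); last by rewrite mulrC.
by rewrite mulrN mulrC.
Qed.

Lemma PC_pulse (t0 t1 tau tau1 tau2 k : R) (v : 'rV[R]_n.+1) :
  tau \in `]t0, t1[ -> tau1 \in `]t0, t1[ -> tau2 \in `]t0, t1[ ->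
  PC t0 t1 (fun t => pulse tau tau1 tau2 k t *: v).
Proof.
by move=> h h1 h2; rewrite pulseE; apply: PC_add; [apply: PC_add|]; exact: PC_step.
Qed.

Lemma frac_int_pulse (a t0 t1 tau tau1 tau2 k t : R) (v : 'rV[R]_n.+1) : 0 < a ->
  tau \in `]t0, t1[ -> tau1 \in `]t0, t1[ -> tau2 \in `]t0, t1[ -> t \in `[t0, t1] ->
  frac_int a t0 (fun t => pulse tau tau1 tau2 k t *: v) t =
  ((Gamma a)^-1 * needle a tau tau1 tau2 k t) *: v.
Proof.
move=> a0 h h1 h2 tI; rewrite pulseE.
have P0 := PC_step v h; have P1 := PC_step (- (1 + k) *: v) h1.
have P2 := PC_step (k *: v) h2.
have e u : u \in `]t0, t1[ -> t0 <= u by rewrite in_itv/= => /andP[/ltW].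
rewrite (frac_intD a0 (PC_add P0 P1) P2 tI) (frac_intD a0 P0 P1 tI).
rewrite !frac_int_step//; try exact: e.
rewrite /needle !scalerA -!scalerDl; congr (_ *: _); ring.
Qed.

Lemma needle_variation (al t0 t1 tau tau1 tau2 k : R) (xo : R -> 'rV[R]_n.+1)
    (x0 x1 xi : 'rV[R]_n.+1) : 0 < al <= 1 -> admissible al t0 t1 x0 x1 xo ->
  t0 < tau -> tau <= tau1 -> tau1 <= tau2 -> tau2 < t1 ->
  needle al tau tau1 tau2 k t1 = 0 ->
  exists x (E : set R), [/\ admissible al t0 t1 x0 x1 x,
    forall t, x t = xo t + ((Gamma al)^-1 * needle al tau tau1 tau2 k t) *: ((caputo_cst al)^-1 *: xi),
    finite_set E
   & forall t, t \in `[t0, t1] -> ~ E t ->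
     [/\ caputo al t0 t1 x t = caputo al t0 t1 xo t + pulse tau tau1 tau2 k t *: xi,
         caputo al t0 t1 (x \- xo) t = pulse tau tau1 tau2 k t *: xi,
         cont_points al t0 t1 x t & cont_points al t0 t1 xo t]].
Proof.
move=> al01 [[cxo [psi pc xoE]] xo0 xo1] t0t h1 h2 tt1 nt1.
have /andP[al0 al1] := al01; have c0 := caputo_cst_gt0 al01.
have t01 : t0 < t1 by lra.
have I0 : tau \in `]t0, t1[ by rewrite in_itv/=; apply/andP; split; lra.
have I1 : tau1 \in `]t0, t1[ by rewrite in_itv/=; apply/andP; split; lra.
have I2 : tau2 \in `]t0, t1[ by rewrite in_itv/=; apply/andP; split; lra.
pose eta := (caputo_cst al)^-1 *: xi.
pose y t := ((Gamma al)^-1 * needle al tau tau1 tau2 k t) *: eta.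
pose x t := xo t + y t.
have pp := PC_pulse k eta I0 I1 I2.
have ps := PC_add pc pp.
have t0I : t0 \in `[t0, t1] by rewrite in_itv/= lexx ltW.
have y0 : y t0 = 0.
  by rewrite /y needle_le0// ?mulr0 ?scale0r// ltW.
have y1 : y t1 = 0 by rewrite /y nt1 mulr0 scale0r.
have yE t : t \in `[t0, t1] -> y t = frac_int al t0 (fun t => pulse tau tau1 tau2 k t *: eta) t.
  by move=> tI; rewrite (frac_int_pulse k eta al0 I0 I1 I2 tI).
have xE t : t \in `[t0, t1] -> x t = x t0 + frac_int al t0 (fun s => psi s + pulse tau tau1 tau2 k s *: eta) t.
  by move=> tI; rewrite (frac_intD al0 pc pp tI) -yE// /x y0 addr0 (xoE t tI) addrA.
(* The weak norm contains the derivative of the difference. It is computed from its own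
   representation, as a limit that may fail to exist cannot be split into two. *)
have dE t : t \in `[t0, t1] -> (x \- xo) t = (x \- xo) t0 + frac_int al t0 (fun s => pulse tau tau1 tau2 k s *: eta) t.
  by move=> tI; rewrite -yE//= /x y0 addr0 subrr add0r addrC addKr.
have [D1 [fD1 _ cE1 _ cp1]] := caputo_PCa al01 t01 pc xoE.
have [D2 [fD2 _ cE2 _ cp2]] := caputo_PCa al01 t01 ps xE.
have [D3 [fD3 _ cE3 _ _]] := caputo_PCa al01 t01 pp dE.
exists x, (D1 `|` D2 `|` D3); split => //.
- split; last 2 first.
  + by rewrite /x y0 addr0.
  + by rewrite /x y1 addr0.
  split; last by exists (fun s => psi s + pulse tau tau1 tau2 k s *: eta).
  apply/subspace_continuousP => t tI; apply: cvgD.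
    by apply: (subspace_continuousP _ _).1 cxo _ _.
  apply: (@cvg_within_filter _ _ y (nbhs t)).
  apply: cvgZr_tmp; apply: cvgM; first exact: cvg_cst.
  exact: needle_continuous.
- by rewrite !finite_setU.
- move=> t tI /not_orP[/not_orP[n1 n2] n3]; split.
  + rewrite (cE2 t tI n2) (cE1 t tI n1) scalerDr !scalerA; congr (_ + _ *: _).
    by rewrite [X in X / _]mulrC mulfK// gt_eqF.
  + rewrite (cE3 t tI n3) !scalerA; congr (_ *: _).
    by rewrite [X in X / _]mulrC mulfK// gt_eqF.
  + exact: cp2.
  + exact: cp1.
Qed.

Lemma pulse_norm_le (tau tau1 tau2 k t : R) : tau <= tau1 -> tau1 <= tau2 -> 0 <= k ->
  `|pulse tau tau1 tau2 k t| <= Num.max 1 k.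
Proof.
move=> h1 h2 k0; rewrite /pulse.
have m1 : 1 <= Num.max 1 k by rewrite le_max lexx.
have m2 : k <= Num.max 1 k by rewrite le_max lexx orbT.
have [a1|a1] := leP tau2 t.
  have -> : tau1 <= t by exact: le_trans a1.
  have -> : tau <= t by rewrite (le_trans h1)// (le_trans h2).
  by rewrite !mulr1 (_ : 1 - (1 + k) + k = 0) ?normr0; [lra|ring].
have [a2|a2] := leP tau1 t.
  have -> : tau <= t by exact: le_trans a2.
  by rewrite !mulr1 mulr0 addr0 (_ : 1 - (1 + k) = - k) ?normrN ?ger0_norm//; ring.
by case: (tau <= t); rewrite ?mulr0 ?subr0 ?addr0 ?normr1 ?normr0 //; lra.
Qed.

(** The restricted function is 0 outside the segment, hence the condition 0 <= M. *)
Lemma norm_Linf_le (t0 t1 M : R) (E : set R) (y : R -> 'rV[R]_n.+1) : 0 <= M ->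
  finite_set E -> (forall t, t \in `[t0, t1] -> ~ E t -> `|y t| <= M) ->
  (norm_Linf t0 t1 y <= M%:E)%E.
Proof.
move=> M0 fE h; apply/ess_supP; exists E; split.
- exact: finite_set_measurable.
- exact: finite_set_null.
move=> t /= H; apply: contrapT => Et; apply: H.
rewrite patchE; case: ifPn; rewrite ?in_set_itv => tI; first by rewrite lee_fin; exact: h.
by rewrite lee_fin.
Qed.

Lemma norm_C_le (t0 t1 M : R) (y : R -> 'rV[R]_n.+1) :
  (forall t, t \in `[t0, t1] -> `|y t| <= M) -> (norm_C t0 t1 y <= M%:E)%E.
Proof. by move=> h; apply: ub_ereal_sup => _ [t tI <-]; rewrite lee_fin; exact: h. Qed.
End variation.

(** * Decrease of the functional along the needle variation *)

Section descent.
Context {R : realType} {n : nat}.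
Notation mu := (@lebesgue_measure R).
Notation E := (R * 'rV[R]_n.+1 * 'rV[R]_n.+1)%type.

Lemma le_Rintegral_finite (A N : set R) (f g : R -> R) : measurable A -> finite_set N ->
  mu.-integrable A (EFin \o f) -> mu.-integrable A (EFin \o g) ->
  (forall t, A t -> ~ N t -> f t <= g t) ->
  \int[mu]_(t in A) f t <= \int[mu]_(t in A) g t.
Proof.
move=> mA fN fi gi fg; have mN := finite_set_measurable fN; have N0 := finite_set_null fN.
rewrite /Rintegral (@negligible_integral _ _ _ mu A N)// [in leRHS](@negligible_integral _ _ _ mu A N)//.
apply: le_Rintegral => //; first exact: measurableD.
- by apply: integrableS fi => //; exact: measurableD.
- by apply: integrableS gi => //; exact: measurableD.
- by move=> t [At Nt]; exact: fg.
Qed.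

(** The bound on [f] is only known outside [N], where [caputo] is specified; [f] is set to 0 on [N]
    before the weight, a Beta kernel, is brought in. *)
Lemma weighted_integrable (be t0 t1 M : R) (N : set R) (f : R -> R) : 0 < be ->
  finite_set N -> measurable_fun `[t0, t1] f ->
  (forall t, t \in `[t0, t1] -> ~ N t -> `|f t| <= M) ->
  mu.-integrable `[t0, t1] (EFin \o (fun t => (t1 - t) `^ (be - 1) * f t)).
Proof.
move=> be0 fN mf fM; have mN := finite_set_measurable fN; have N0 := finite_set_null fN.
pose f' := f \_ (~` N).
have mf' : measurable_fun `[t0, t1] f'.
  apply: (measurable_fun_setD_finite _ fN) => //.
  apply: (@eq_measurable_fun _ _ _ _ _ f).
    by move=> t; rewrite inE => -[_ Nt]; rewrite /f' patchE ifT// inE.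
  by apply: measurable_funS mf => // t [].
have mk (h : R -> R) : measurable_fun `[t0, t1] h ->
    measurable_fun `[t0, t1] (EFin \o (fun t => (t1 - t) `^ (be - 1) * h t)).
  move=> mh; apply/measurable_EFinP; apply: measurable_funM => //.
  by apply: measurable_funS (measurable_powR_subl t1 (be - 1)).
have i' : mu.-integrable `[t0, t1] (EFin \o (fun t => (t1 - t) `^ (be - 1) * f' t)).
  apply: (@kernel_mul_integrable _ _ _ _ `|M|) => // t tI; rewrite /f' patchE.
  case: ifPn; last by rewrite normr0.
  by rewrite inE => Nt; apply: le_trans (fM t tI Nt) _; exact: ler_norm.
apply: (@negligible_integrable _ _ _ mu `[t0, t1] N _ mN (measurable_itv _) (mk _ mf) N0).2.
have := (@negligible_integrable _ _ _ mu `[t0, t1] N _ mN (measurable_itv _) (mk _ mf') N0).1 i'.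
apply: eq_integrable; first exact: measurableD.
by move=> t; rewrite inE => -[_ Nt] /=; rewrite /f' patchE ifT// inE.
Qed.

(** Off [N] the integrand without its weight is a composition of continuous maps, hence measurable;
    boundedness then suffices against the weight. *)
Lemma integrand_defined (al be t0 t1 M : R) (N : set R) (phi : R -> 'rV[R]_n.+1)
    (L : R -> 'rV[R]_n.+1 -> 'rV[R]_n.+1 -> R) : 0 < be -> finite_set N ->
  {within `[t0, t1]%classic, continuous phi} ->
  (forall t, t \in `[t0, t1] -> ~ N t ->
    [/\ cont_points al t0 t1 phi t,
       {for (t, phi t, caputo al t0 t1 phi t), continuous (fun q : E => L q.1.1 q.1.2 q.2)}
      & `|L t (phi t) (caputo al t0 t1 phi t)| <= M]) ->
  J_defined al be t0 t1 L phi.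
Proof.
move=> be0 fN cphi h; apply: (@weighted_integrable _ _ _ M N) => //; last first.
  by move=> t tI Nt; have [] := h t tI Nt.
apply: (measurable_fun_setD_finite _ fN) => //.
apply: subspace_continuous_measurable_fun.
  by apply: measurableD => //; exact: finite_set_measurable.
apply/subspace_continuousP => t [/= tI Nt]; have [[_ cc] cL _] := h t tI Nt.
apply: (@cvg_trans _ ((fun s => L s (phi s) (caputo al t0 t1 phi s)) @ within `[t0, t1]%classic (nbhs t))).
  by apply: cvg_app; apply: within_subset => s [].
apply: (@cvg_comp _ _ _ (fun s => (s, phi s, caputo al t0 t1 phi s)) (fun q : E => L q.1.1 q.1.2 q.2)
  _ (nbhs (t, phi t, caputo al t0 t1 phi t))); last exact: cL.
have h0 : s @[s --> within `[t0, t1]%classic (nbhs t)] --> t by exact: cvg_within.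
have h1 : phi s @[s --> within `[t0, t1]%classic (nbhs t)] --> phi t.
  by apply: (subspace_continuousP _ _).1 cphi _ _.
exact: (cvg_pair (cvg_pair h0 h1) cc).
Qed.

Lemma weighted_continuous (be t1 : R) (L : R -> 'rV[R]_n.+1 -> 'rV[R]_n.+1 -> R) (q : E) :
  q.1.1 < t1 -> {for q, continuous (fun q : E => L q.1.1 q.1.2 q.2)} ->
  {for q, continuous (fun q : E => (t1 - q.1.1) `^ (be - 1) * L q.1.1 q.1.2 q.2)}.
Proof.
move=> qt1 cL; apply: cvgM => //.
have c1 : {for t1 - q.1.1, continuous (fun u : R => u `^ (be - 1))}.
  have h0 : 0 < t1 - q.1.1 by rewrite subr_gt0.
  have [h _] := is_derive1_powR (be - 1) h0.
  exact/differentiable_continuous/derivable1_diffP.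
apply: (@cvg_comp _ _ _ (fun q : E => t1 - q.1.1) (fun u => u `^ (be - 1)) _ (nbhs (t1 - q.1.1))) => //.
apply: cvgB; first exact: cvg_cst.
by apply: (@cvg_comp _ _ _ (fun q : E => q.1) fst _ (nbhs q.1)); exact: cvg_fst.
Qed.

(** The weight is included in the continuity estimate, which is possible away from its singularity
    at [t1]; the bound on L alone serves integrability. *)
Lemma needle_ball (L : R -> 'rV[R]_n.+1 -> 'rV[R]_n.+1 -> R) (V : set E) (be t1 e : R) (q : E) :
  open V -> V q -> q.1.1 < t1 -> 0 < e ->
  (forall p, V p -> {for p, continuous (fun q : E => L q.1.1 q.1.2 q.2)}) ->
  exists2 d : R, 0 < d & forall p, ball q d p ->
   [/\ V p, `|L p.1.1 p.1.2 p.2| <= `|L q.1.1 q.1.2 q.2| + 1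
     & `|(t1 - p.1.1) `^ (be - 1) * L p.1.1 p.1.2 p.2 -
         (t1 - q.1.1) `^ (be - 1) * L q.1.1 q.1.2 q.2| < e].
Proof.
move=> oV Vq qt1 e0 cL.
have /cvgrPdist_lt /(_ 1 ltr01) n1 := cL _ Vq.
have /cvgrPdist_lt /(_ e e0) n2 := @weighted_continuous be t1 L q qt1 (cL _ Vq).
have nV : nbhs q V by exact: open_nbhs_nbhs.
have [d /= d0 hd] := (nbhs_ballP _ _).1 (filterI nV (filterI n1 n2)).
exists d => // p /hd[Vp [h1 h2]]; split => //; last by rewrite distrC.
rewrite -[X in `|X|](subKr (L q.1.1 q.1.2 q.2)).
by apply: le_trans (ler_normB _ _) _; rewrite lerD2l ltW.
Qed.


Lemma Rintegral_itv_split3 (f : R -> R) (t0 a b c t1 : R) : t0 <= a -> a <= b -> b <= c -> c <= t1 ->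
  mu.-integrable `[t0, t1] (EFin \o f) ->
  \int[mu]_(t in `[t0, t1]) f t = \int[mu]_(t in `[t0, a]) f t + \int[mu]_(t in `]a, b]) f t +
    \int[mu]_(t in `]b, c]) f t + \int[mu]_(t in `]c, t1]) f t.
Proof.
move=> h1 h2 h3 h4 fi.
have sub (u v : R) : t0 <= u -> v <= t1 -> mu.-integrable `]u, v] (EFin \o f).
  move=> u0 v1; apply: integrableS fi => // t /=; rewrite !in_itv/= => /andP[ut tv].
  by rewrite (le_trans u0 (ltW ut)) (le_trans tv v1).
have e1 : \int[mu]_(t in `[t0, t1]) f t - \int[mu]_(t in `[t0, a]) f t = \int[mu]_(t in `]a, t1]) f t.
  by apply: Rintegral_itvB; rewrite ?bnd_simp//; lra.
have e2 : \int[mu]_(t in `]a, t1]) f t - \int[mu]_(t in `]a, b]) f t = \int[mu]_(t in `]b, t1]) f t.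
  by apply: Rintegral_itvB; rewrite ?bnd_simp//; [apply: sub|]; lra.
have e3 : \int[mu]_(t in `]b, t1]) f t - \int[mu]_(t in `]b, c]) f t = \int[mu]_(t in `]c, t1]) f t.
  by apply: Rintegral_itvB; rewrite ?bnd_simp//; apply: sub; lra.
by rewrite -e3 -e2 -e1; ring.
Qed.

Lemma Rintegral_itvoc_le (f : R -> R) (N : set R) (s t c : R) : s <= t -> finite_set N ->
  mu.-integrable `]s, t] (EFin \o f) -> (forall u, u \in `]s, t] -> ~ N u -> f u <= c) ->
  \int[mu]_(u in `]s, t]) f u <= c * (t - s).
Proof.
move=> st fN fi fc.
have mst : (mu `]s, t] < +oo)%E.
  by rewrite lebesgue_measure_itv/=; case: ifPn => //; rewrite -EFinB ltry.
have lst : fine (mu `]s, t]) = t - s.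
  rewrite lebesgue_measure_itv/= lte_fin; case: (ltP s t) => [_|ts].
    by rewrite -EFinB.
  by rewrite (@le_anti _ _ s t) ?st ?ts// subrr.
have <- : \int[mu]_(u in `]s, t]) c = c * (t - s) by rewrite Rintegral_cst// lst.
by apply: (@le_Rintegral_finite _ N) => //; exact: integrable_cst.
Qed.

(** The three switching points join the exceptional set, so only strict positions of t have to be
    considered. *)
Lemma integral_needle_le (F : R -> R) (N : set R) (t0 tau tau1 tau2 t1 c1 c2 c3 : R) :
  t0 <= tau -> tau <= tau1 -> tau1 <= tau2 -> tau2 <= t1 -> finite_set N ->
  mu.-integrable `[t0, t1] (EFin \o F) ->
  (forall t, t \in `[t0, t1] -> ~ N t -> t < tau -> F t <= 0) ->
  (forall t, t \in `[t0, t1] -> ~ N t -> tau < t -> t < tau1 -> F t <= c1) ->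
  (forall t, t \in `[t0, t1] -> ~ N t -> tau1 < t -> t < tau2 -> F t <= c2) ->
  \int[mu]_(t in `]tau2, t1]) F t <= c3 ->
  \int[mu]_(t in `[t0, t1]) F t <= c1 * (tau1 - tau) + c2 * (tau2 - tau1) + c3.
Proof.
move=> h1 h2 h3 h4 fN iF H0 H1 H2 H3.
rewrite (@Rintegral_itv_split3 F t0 tau tau1 tau2 t1)//.
have fN' : finite_set (N `|` [set tau; tau1; tau2]).
  by rewrite finite_setU; split => //; rewrite finite_setU; split => //; rewrite finite_setU.
have sub (u v : R) : t0 <= u -> v <= t1 -> mu.-integrable `]u, v] (EFin \o F).
  move=> u0 v1; apply: integrableS iF => // t /=; rewrite !in_itv/= => /andP[ut tv].
  by rewrite (le_trans u0 (ltW ut)) (le_trans tv v1).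
have B0 : \int[mu]_(t in `[t0, tau]) F t <= 0.
  have <- : \int[mu]_(t in `[t0, tau]) (0 : R) = 0 by rewrite Rintegral_cst// mul0r.
  have sub0 : `[t0, tau]%classic `<=` `[t0, t1]%classic.
    by move=> t /=; rewrite !in_itv/= => /andP[-> ttau]; lra.
  apply: (@le_Rintegral_finite _ (N `|` [set tau; tau1; tau2])) => //.
  - exact: integrableS iF.
  - by apply: eq_integrable (integrable0 _ _).
  - move=> t tI /not_orP[Nt nt]; apply: H0 => //; first exact: sub0.
    move: tI; rewrite /= in_itv/= lt_neqAle => /andP[_ ->]; rewrite andbT.
    by apply/eqP => tE; apply: nt; left; left.
have B1 : \int[mu]_(t in `]tau, tau1]) F t <= c1 * (tau1 - tau).
  apply: (Rintegral_itvoc_le _ fN') => //; first by apply: sub => //; lra.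
  move=> t; rewrite in_itv/= => /andP[a1 a2] /not_orP[Nt nt]; apply: H1 => //.
    by rewrite in_itv/=; apply/andP; split; lra.
  by rewrite lt_neqAle a2 andbT; apply/eqP => tE; apply: nt; left; right.
have B2 : \int[mu]_(t in `]tau1, tau2]) F t <= c2 * (tau2 - tau1).
  apply: (Rintegral_itvoc_le _ fN') => //; first by apply: sub => //; lra.
  move=> t; rewrite in_itv/= => /andP[a1 a2] /not_orP[Nt nt]; apply: H2 => //.
    by rewrite in_itv/=; apply/andP; split; lra.
  by rewrite lt_neqAle a2 andbT; apply/eqP => tE; apply: nt; right.
lra.
Qed.

Lemma pos_lower_bound (s : seq R) : all (fun x => 0 < x) s ->
  exists2 e : R, 0 < e & all (fun x => e <= x) s.
Proof.
elim: s => [_|x s ih /= /andP[x0 /ih[e e0 es]]]; first by exists 1.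
exists (Num.min x e); first by rewrite lt_min x0.
rewrite ge_min lexx/=; apply: sub_all es => y ey.
by rewrite ge_min ey orbT.
Qed.

Lemma pulse_outside (tau tau1 tau2 k t : R) : tau <= tau1 -> tau1 <= tau2 ->
  t < tau \/ tau2 < t -> pulse tau tau1 tau2 k t = 0.
Proof.
move=> h1 h2 [ct|ct]; rewrite /pulse.
  have n1 := lt_le_trans ct h1; have n2 := lt_le_trans n1 h2.
  by rewrite !leNgt ct n1 n2/= !mulr0 subr0 addr0.
have n1 := le_lt_trans h2 ct; have n0 := le_lt_trans h1 n1.
by rewrite (ltW ct) (ltW n1) (ltW n0)/= !mulr1; ring.
Qed.

Lemma pulse_first (tau tau1 tau2 k t : R) : tau1 <= tau2 ->
  tau < t -> t < tau1 -> pulse tau tau1 tau2 k t = 1.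
Proof.
move=> h2 c1 c2; rewrite /pulse (ltW c1) !leNgt c2 (lt_le_trans c2 h2)/=.
by rewrite !mulr0 subr0 addr0.
Qed.

Lemma pulse_second (tau tau1 tau2 k t : R) : tau <= tau1 ->
  tau1 < t -> t < tau2 -> pulse tau tau1 tau2 k t = - k.
Proof.
move=> h1 c1 c2; rewrite /pulse (ltW c1) (ltW (le_lt_trans h1 c1)) leNgt c2/=.
by rewrite !mulr1 mulr0; ring.
Qed.

Lemma graph_lipschitz (L : R -> 'rV[R]_n.+1 -> 'rV[R]_n.+1 -> R) (A U : set E) (r C : R) t x y z :
  (forall p, U p -> differentiable (fun z => L p.1.1 z p.2) p.1.2) ->
  (forall p q, closure A p -> ball p r q ->
      [/\ U q, `|L q.1.1 q.1.2 q.2| <= C & `|grad_x L q.1.1 q.1.2 q.2| <= C]) ->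
  closure A (t, x, y) -> `|z - x| < r ->
  [/\ U (t, z, y), `|L t z y| <= C & `|L t z y - L t x y| <= n.+1%:R * C * `|z - x|].
Proof.
move=> dU hU Ap zr; have r0 : 0 < r by exact: le_lt_trans zr.
have hb (q : E) : ball ((t, x, y) : E) r q -> U q /\ `|grad_x L q.1.1 q.1.2 q.2| <= C.
  by move=> bq; have [] := hU (t, x, y) q Ap bq.
have bq : ball ((t, x, y) : E) r (t, z, y).
  split; last exact: ballxx.
  by split; [exact: ballxx|rewrite -ball_normE /ball_/= distrC].
have [Ut Lt _] := hU (t, x, y) (t, z, y) Ap bq; split => //.
exact: (@lipschitz_near _ _ L U r C (t, x, y) z dU hb zr).
Qed.

Lemma ball_triple (t s r : R) (x x' y y' : 'rV[R]_n.+1) :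
  `|t - s| < r -> `|x - x'| < r -> `|y - y'| < r -> ball ((t, x, y) : E) r (s, x', y').
Proof. by move=> h1 h2 h3; split; [split|] => //; rewrite -ball_normE. Qed.

Lemma weighted_diff_le (u v A B A' B' e : R) : `|u * A - v * A'| < e -> `|u * B - v * B'| < e ->
  u * (A - B) <= v * (A' - B') + 2 * e.
Proof. by rewrite !ltr_norml !mulrBr => /andP[_ h1] /andP[h2 _]; lra. Qed.

(** Dividing by K + 1 avoids a separate case K = 0 when constants are chosen. *)
Lemma mul_div_succ_le (K x e : R) : 0 <= K -> 0 <= e -> e <= x / (K + 1) -> K * e <= x.
Proof.
move=> K0 e0; have K1 : 0 < K + 1 by rewrite ltr_wpDl.
rewrite ler_pdivlMr// => h; apply: le_trans h; rewrite mulrC.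
by apply: ler_wpM2l => //; rewrite lerDl.
Qed.

Lemma J_sub (al be t0 t1 : R) (L : R -> 'rV[R]_n.+1 -> 'rV[R]_n.+1 -> R)
    (x y : R -> 'rV[R]_n.+1) :
  J_defined al be t0 t1 L x -> J_defined al be t0 t1 L y ->
  let F t := (t1 - t) `^ (be - 1) *
    (L t (x t) (caputo al t0 t1 x t) - L t (y t) (caputo al t0 t1 y t)) in
  mu.-integrable `[t0, t1] (EFin \o F) /\
  J al be t0 t1 L x - J al be t0 t1 L y = \int[mu]_(t in `[t0, t1]) F t.
Proof.
move=> hf hg F.
have aux (f g : R -> R) : (forall t, F t = f t - g t) ->
    mu.-integrable `[t0, t1] (EFin \o f) -> mu.-integrable `[t0, t1] (EFin \o g) ->
    mu.-integrable `[t0, t1] (EFin \o F) /\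
    \int[mu]_(t in `[t0, t1]) f t - \int[mu]_(t in `[t0, t1]) g t = \int[mu]_(t in `[t0, t1]) F t.
  move=> FE fi gi; split.
    by apply: eq_integrable (integrableB _ fi gi) => // t _; rewrite /= FE EFinB.
  by rewrite -RintegralB//; apply: eq_Rintegral => t _; rewrite FE.
by apply: aux hf hg => t; rewrite /F /integrand mulrBr.
Qed.

(** Every contribution is at most a multiple of h, so the sign is that of the coefficient a c1 + b
    c2 + K e. *)
Lemma needle_integral_lt0 (al be t0 tau tau1 tau2 t1 k a b h e K c1 c2 : R) (N : set R) (F : R -> R) :
  0 < al <= 1 -> 0 < be -> t0 <= tau -> tau < tau1 -> tau1 < tau2 -> tau2 < t1 ->
  tau1 - tau = a * h -> tau2 - tau1 = b * h -> 0 < h -> 0 <= K -> finite_set N ->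
  (forall t, `|needle al tau tau1 tau2 k t| <= e) ->
  \int[mu]_(t in `]tau2, t1])
    ((t1 - t) `^ (be - 1) * `|needle al tau tau1 tau2 k t|) <= e * h ->
  mu.-integrable `[t0, t1] (EFin \o F) ->
  (forall t, t \in `[t0, t1] -> ~ N t -> t < tau \/ tau2 < t ->
    F t <= K * ((t1 - t) `^ (be - 1) * `|needle al tau tau1 tau2 k t|)) ->
  (forall t, t \in `[t0, t1] -> ~ N t -> tau < t -> t < tau1 -> F t <= c1) ->
  (forall t, t \in `[t0, t1] -> ~ N t -> tau1 < t -> t < tau2 -> F t <= c2) ->
  a * c1 + b * c2 + K * e < 0 ->
  \int[mu]_(t in `[t0, t1]) F t < 0.
Proof.
move=> al01 be0 t0tau T1 T2 t2t1 T1E T2E h0 K0 fN nle nint iF off on1 on2 neg.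
have [al0 _] := andP al01.
have B3 : \int[mu]_(t in `]tau2, t1]) F t <= K * (e * h).
  have sub : `]tau2, t1]%classic `<=` `[t0, t1]%classic.
    move=> t /=; rewrite !in_itv/= => /andP[h1 ->]; rewrite andbT.
    by move: h1 T2 T1 t0tau; clear; lra.
  have iw : mu.-integrable `]tau2, t1]
      (EFin \o (fun t => (t1 - t) `^ (be - 1) * `|needle al tau tau1 tau2 k t|)).
    apply: (@integrableS _ _ _ mu `[t0, t1]) => //.
    apply: (@kernel_mul_integrable _ _ _ _ e) => //.
      apply: measurableT_comp => //; apply: measurable_funTS.
      by apply: continuous_measurable_fun; exact: needle_continuous.
    by move=> t _; rewrite normr_id.
  apply: (@le_trans _ _ (K * \int[mu]_(t in `]tau2, t1])
      ((t1 - t) `^ (be - 1) * `|needle al tau tau1 tau2 k t|))); last exact: ler_wpM2l.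
  rewrite -RintegralZl//; apply: (@le_Rintegral_finite _ N) => //.
  - exact: integrableS iF.
  - by apply: eq_integrable (integrableZl _ K iw).
  move=> t tI' Nt; have tI := sub t tI'; move: tI'; rewrite /= in_itv/= => /andP[h1 h2].
  exact: off t tI Nt (or_intror h1).
apply: le_lt_trans (integral_needle_le t0tau (ltW T1) (ltW T2) (ltW t2t1) fN iF _ on1 on2 B3) _.
  move=> t tI Nt tlt; have := off t tI Nt (or_introl tlt).
  by rewrite needle_le0 ?normr0 ?mulr0// ltW.
rewrite T1E T2E.
have -> : c1 * (a * h) + c2 * (b * h) + K * (e * h) = (a * c1 + b * c2 + K * e) * h by ring.
by rewrite nmulr_rlt0.
Qed.

(** [V] is where L is continuous around the two shifted points; keeping it abstract lets a
    neighbourhood of the cylinder serve the strong case and one of the graph the weak case. The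
    bound on the derivative of the variation does not involve [d]. *)
Lemma needle_descent (al be t0 t1 : R) (x0 x1 xi : 'rV[R]_n.+1)
    (L : R -> 'rV[R]_n.+1 -> 'rV[R]_n.+1 -> R) (xo : R -> 'rV[R]_n.+1)
    (V : set E) (tau a b d : R) :
  0 < al <= 1 -> 0 < be -> admissible al t0 t1 x0 x1 xo ->
  L_Lx_continuous_near L (graph al t0 t1 xo) ->
  open V -> (forall p, V p -> {for p, continuous (fun q : E => L q.1.1 q.1.2 q.2)}) ->
  tau \in `]t0, t1[ -> cont_points al t0 t1 xo tau -> 0 < a -> 0 < b -> 0 < d ->
  let D := caputo al t0 t1 xo in
  V (tau, xo tau, D tau + xi) -> V (tau, xo tau, D tau - (a / b) *: xi) ->
  a * L tau (xo tau) (D tau + xi) + b * L tau (xo tau) (D tau - (a / b) *: xi)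
    - (a + b) * L tau (xo tau) (D tau) < 0 ->
  exists x, [/\ admissible al t0 t1 x0 x1 x, J_defined al be t0 t1 L x,
    (norm_C t0 t1 (x \- xo)%R <= d%:E)%E,
    (norm_Linf t0 t1 (caputo al t0 t1 (x \- xo)%R) <= (Num.max 1 (a / b) * `|xi|)%:E)%E
    & J al be t0 t1 L x < J al be t0 t1 L xo].
Proof.
move=> al01 be0 adm LL oV cV tauI tauT a0 b0 d0 D Vq1 Vq2 neg.
have : D = caputo al t0 t1 xo by []; move: D Vq1 Vq2 neg => D Vq1 Vq2 neg DE.
have [al0 _] := andP al01.
move: (tauI); rewrite in_itv/= => /andP[t0tau taut1].
have t01 : t0 < t1 by exact: lt_trans taut1.
have [pca _ _] := adm; have [cxo _] := pca.
have [r [C [U [r0 oU cU dU hU]]]] :=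
  uniform_graph_neighbourhood (closure_graph_compact al01 t01 pca) LL.
have inG t : cont_points al t0 t1 xo t -> closure (graph al t0 t1 xo) (t, xo t, D t).
  by move=> tT; apply: subset_closure; exists t; rewrite ?DE.
have [Uq0 _ Cq0] := hU _ _ (inG _ tauT) (ballxx _ r0).
have C0 : 0 <= C by apply: le_trans Cq0.
have [w wE] : exists w : R -> R, w = fun t => (t1 - t) `^ (be - 1) by eexists.
have w0 : 0 < w tau by rewrite wE powR_gt0// subr_gt0.
have [L0 L0E] : exists L0, L0 = L tau (xo tau) (D tau) by eexists.
have [L1 L1E] : exists L1, L1 = L tau (xo tau) (D tau + xi) by eexists.
have [L2 L2E] : exists L2, L2 = L tau (xo tau) (D tau - (a / b) *: xi) by eexists.
rewrite -L0E -L1E -L2E in neg.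
have [del delE] : exists del, del = - (w tau * (a * L1 + b * L2 - (a + b) * L0)) by eexists.
have del0 : 0 < del by rewrite delE oppr_gt0 pmulr_rlt0.
have ab0 : 0 < a + b by rewrite addr_gt0.
have abq : 0 < a / b by rewrite divr_gt0.
(* Each part of the pulse loses 2 e' per unit of length, in total 2 e' (a + b) = del/4 in the
   coefficient of h. The tail costs at most another del/4, so at most - del/2 remains. *)
have [e' e'E] : exists e', e' = del / (8 * (a + b)) by eexists.
have e'0 : 0 < e' by rewrite e'E divr_gt0// mulr_gt0.
have [r1 r10 hr1] := @needle_ball L V be t1 e' _ oV Vq1 taut1 e'0 cV.
have [r2 r20 hr2] := @needle_ball L V be t1 e' _ oV Vq2 taut1 e'0 cV.
have [r3 r30 hr3] := @needle_ball L U be t1 e' _ oU Uq0 taut1 e'0 cU.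
rewrite /= -L1E in hr1; rewrite /= -L2E in hr2; rewrite /= -L0E in hr3.
have [|rho rho0 /=] := @pos_lower_bound [:: r1; r2; r3]; first by rewrite /= r10 r20 r30.
rewrite andbT => /and3P[rr1 rr2 rr3].
have rho2 : 0 < rho / 2 by rewrite divr_gt0.
have [_ cD] := tauT; rewrite /continuous_on_at -DE in cD.
have cX : xo s @[s --> within `[t0, t1]%classic (nbhs tau)] --> xo tau.
  by apply: (subspace_continuousP _ _).1 cxo _ _; rewrite /= in_itv/= !ltW.
move/cvgrPdist_lt : cX => /(_ _ rho2); rewrite near_withinE => nX.
move/cvgrPdist_lt : cD => /(_ _ rho2); rewrite near_withinE => nD.
have [dl /= dl0 hdl] := (nbhs_ballP _ _).1 (filterI nX nD).
have [K [K0 KE]] : exists K : R, 0 <= K /\ K = `|(Gamma al)^-1| * `|(caputo_cst al)^-1 *: xi|.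
  by eexists; split; last reflexivity; rewrite mulr_ge0.
have d2 : 0 < d / 2 by rewrite divr_gt0.
have r2' : 0 < r / 2 by rewrite divr_gt0.
have rho4 : 0 < rho / 4 by rewrite divr_gt0.
(* [m] will bound |x - xo|: rho/4 for the balls around the evaluation points, r/2 for the Lipschitz
   estimate, d for the required distance. *)
have [|m m0 /=] := @pos_lower_bound [:: rho / 4; r / 2; d].
  by rewrite /= rho4 r2' d0.
rewrite andbT => /and3P[mrho mr md].
have {mr}mr : m < r by apply: le_lt_trans mr _; rewrite ltr_pdivrMr// ltr_pMr// ltr1n.
have [KL [KL0 KLE]] : exists KL : R, 0 <= KL /\ KL = n.+1%:R * C * K.
  by eexists; split; last reflexivity; rewrite !mulr_ge0.
have K1 : 0 < K + 1 by rewrite ltr_wpDl.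
have KL1 : 0 < KL + 1 by rewrite ltr_wpDl.
have xi1 : 0 < `|xi| + 1 by rewrite ltr_wpDl.
(* In turn: rho and dl keep the pulse near tau, the third entry gives |x - xo| <= m, the fourth
   makes the replacement of k by a/b harmless, the last bounds the tail. *)
have [|e e0 /=] := @pos_lower_bound [:: rho; dl; m / (K + 1); rho / 2 / (`|xi| + 1); del / 4 / (KL + 1)].
  by rewrite /= rho0 dl0 !divr_gt0.
rewrite andbT => /and5P[er edl em exi eKL].
have [h [k [[h0 t2t1 she [k0 kab ake]] nt1 nle nint]]] :=
  needle_exists al01 be0 taut1 a0 b0 e0.
have [tau1 tau1E] : exists tau1, tau1 = tau + a * h by eexists.
rewrite -tau1E in t2t1 nt1 nle nint.
have [tau2 tau2E] : exists tau2, tau2 = tau1 + b * h by eexists.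
rewrite -tau2E in t2t1 nt1 nle nint.
have ah0 : 0 < a * h by rewrite mulr_gt0.
have bh0 : 0 < b * h by rewrite mulr_gt0.
have T1 : tau < tau1 by rewrite tau1E ltrDl.
have T2 : tau1 < tau2 by rewrite tau2E ltrDl.
have T12 : tau2 - tau = a * h + b * h by rewrite tau2E tau1E; ring.
have [x [N0 [admx xE fN0 hx]]] :=
  needle_variation xi al01 adm t0tau (ltW T1) (ltW T2) t2t1 nt1.
pose N := N0 `|` [set tau; tau1; tau2].
have fN : finite_set N.
  by rewrite finite_setU; split => //; rewrite finite_setU; split => //; rewrite finite_setU.
have hN t : t \in `[t0, t1] -> ~ N t ->
     [/\ caputo al t0 t1 x t = D t + pulse tau tau1 tau2 k t *: xi,
         caputo al t0 t1 (x \- xo) t = pulse tau tau1 tau2 k t *: xi,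
         cont_points al t0 t1 x t & cont_points al t0 t1 xo t].
  by move=> tI /not_orP[Nt _]; rewrite DE; exact: hx.
have xd t : `|x t - xo t| <= K * `|needle al tau tau1 tau2 k t|.
  by rewrite xE addrC addKr normrZ normrM KE mulrAC.
have xm t : `|x t - xo t| <= m.
  apply: le_trans (xd t) (le_trans _ (mul_div_succ_le K0 (ltW e0) em)).
  by apply: ler_wpM2l.
have KLe : KL * e <= del / 4 by exact: mul_div_succ_le (ltW e0) eKL.
have xie : `|xi| * e <= rho / 2 by exact: mul_div_succ_le (ltW e0) exi.
have [Dx DxE] : exists Dx, Dx = caputo al t0 t1 x.
  exists (caputo al t0 t1 x); reflexivity.
have near_tau t : tau < t -> t < tau2 -> [/\ `|tau - t| < rho, `|xo tau - x t| < rho,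
    `|xo tau - xo t| < rho & `|D tau - D t| < rho / 2].
  move=> h1 h2.
  have tt : `|tau - t| < e.
    by rewrite distrC gtr0_norm ?subr_gt0//; move: h2 she T12; clear; lra.
  have tI : t \in `[t0, t1].
    by rewrite in_itv/= (ltW (lt_trans t0tau h1)) (ltW (lt_trans h2 t2t1)).
  have bt : ball tau dl t by exact: lt_le_trans edl.
  have [h3 h4] := hdl _ bt; have {}h3 := h3 tI; have {}h4 := h4 tI.
  split => //; first exact: lt_le_trans er.
  - have -> : xo tau - x t = (xo tau - xo t) - (x t - xo t).
      by rewrite opprB addrA subrK.
    apply: le_lt_trans (ler_normB _ _) _; have := xm t.
    by move: h3 mrho rho0; clear; lra.
  - by move: h3 rho0; clear; lra.
(* Off the pulse the derivative is unchanged, so only the second argument of L moves and the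
   Lipschitz constant along the graph applies. *)
have off t : t \in `[t0, t1] -> ~ N t -> t < tau \/ tau2 < t ->
    [/\ U (t, x t, Dx t), `|L t (x t) (Dx t)| <= C &
      `|L t (x t) (Dx t) - L t (xo t) (D t)| <= n.+1%:R * C * `|x t - xo t|].
  move=> tI Nt ct; have [xDE _ _ To] := hN t tI Nt.
  rewrite DxE xDE (pulse_outside k (ltW T1) (ltW T2) ct) scale0r addr0.
  by apply: (graph_lipschitz dU hU (inG t To)); exact: le_lt_trans (xm t) mr.
have base t : tau < t -> t < tau2 -> `|w t * L t (xo t) (D t) - w tau * L0| < e'.
  move=> c1 c2; have [n1 _ n3 n4] := near_tau t c1 c2.
  have n5 : `|D tau - D t| < rho by move: n4 rho0; clear; lra.
  have [_ _ P0] := hr3 _ (le_ball rr3 (ball_triple n1 n3 n5)).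
  by rewrite wE; exact: P0.
have on1 t : t \in `[t0, t1] -> ~ N t -> tau < t -> t < tau1 ->
    [/\ V (t, x t, Dx t), `|L t (x t) (Dx t)| <= `|L1| + 1 &
      w t * (L t (x t) (Dx t) - L t (xo t) (D t)) <= w tau * (L1 - L0) + 2 * e'].
  move=> tI Nt c1 c2; have c3 := lt_trans c2 T2.
  have [xDE _ _ _] := hN t tI Nt.
  have [n1 n2 n3 n4] := near_tau t c1 c3.
  have n5 : `|D tau + xi - (Dx t)| < rho.
    rewrite DxE xDE (pulse_first k (ltW T2) c1 c2) scale1r opprD addrACA subrr addr0.
    by move: n4 rho0; clear; lra.
  have [Vt Lt Pt] := hr1 _ (le_ball rr1 (ball_triple n1 n2 n5)); split => //.
  apply: weighted_diff_le; last exact: base.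
  by rewrite wE; exact: Pt.
have on2 t : t \in `[t0, t1] -> ~ N t -> tau1 < t -> t < tau2 ->
    [/\ V (t, x t, Dx t), `|L t (x t) (Dx t)| <= `|L2| + 1 &
      w t * (L t (x t) (Dx t) - L t (xo t) (D t)) <= w tau * (L2 - L0) + 2 * e'].
  move=> tI Nt c1 c2; have c3 := lt_trans T1 c1.
  have [xDE _ _ _] := hN t tI Nt.
  have [n1 n2 n3 n4] := near_tau t c3 c2.
  have n5 : `|D tau - (a / b) *: xi - (Dx t)| < rho.
    rewrite DxE xDE (pulse_second k (ltW T1) c1 c2).
    (* Half of rho goes to the continuity of the derivative at tau, the other half to the error (a/b
       - k)|xi|. *)
    have -> : D tau - (a / b) *: xi - (D t + - k *: xi) = (D tau - D t) - (a / b - k) *: xi.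
      rewrite scalerBl scaleNr !opprB -!addrA; congr (_ + _).
      by rewrite addrCA [RHS]addrCA; congr (_ + _); rewrite addrC.
    apply: le_lt_trans (ler_normB _ _) _; rewrite normrZ ger0_norm ?subr_ge0//.
    have : (a / b - k) * `|xi| <= rho / 2.
      by apply: le_trans xie; rewrite mulrC; apply: ler_wpM2l => //; exact: ltW.
    by move: n4; clear; lra.
  have [Vt Lt Pt] := hr2 _ (le_ball rr2 (ball_triple n1 n2 n5)); split => //.
  apply: weighted_diff_le; last exact: base.
  by rewrite wE; exact: Pt.
have cases t : ~ N t -> [\/ t < tau \/ tau2 < t, tau < t /\ t < tau1 | tau1 < t /\ t < tau2].
  move=> /not_orP[_ /not_orP[/not_orP[/eqP n0 /eqP n1] /eqP n2]].
  have [c1|c1|c1] := ltgtP t tau; [by constructor 1; left| |by rewrite c1 eqxx in n0].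
  have [c2|c2|c2] := ltgtP t tau1; [by constructor 2| |by rewrite c2 eqxx in n1].
  have [c3|c3|c3] := ltgtP t tau2; [by constructor 3| |by rewrite c3 eqxx in n2].
  by constructor 1; right.
have JDx : J_defined al be t0 t1 L x.
  have [[cx _] _ _] := admx.
  apply: (integrand_defined (M := C + (`|L1| + 1) + (`|L2| + 1)) be0 fN cx) => t tI Nt.
  have [_ _ Tx _] := hN t tI Nt; rewrite -DxE.
  have l1 := normr_ge0 L1; have l2 := normr_ge0 L2.
  case: (cases t Nt) => [c|[c1 c2]|[c1 c2]].
  - have [Ut Lt _] := off t tI Nt c; split => //; first exact: cU.
    by move: Lt l1 l2; clear; lra.
  - have [Vt Lt _] := on1 t tI Nt c1 c2; split => //; first exact: cV.
    by move: Lt l1 l2 C0; clear; lra.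
  - have [Vt Lt _] := on2 t tI Nt c1 c2; split => //; first exact: cV.
    by move: Lt l1 l2 C0; clear; lra.
have JDo : J_defined al be t0 t1 L xo.
  apply: (integrand_defined (M := C) be0 fN cxo) => t tI Nt; rewrite -DE.
  have [_ _ _ To] := hN t tI Nt.
  by have [Ut Lt _] := hU _ _ (inG _ To) (ballxx _ r0); split => //; exact: cU.
exists x; split => //.
- by apply: norm_C_le => t _; apply: le_trans (xm t) md.
- apply: (norm_Linf_le _ fN); first by rewrite mulr_ge0// le_max ler01.
  move=> t tI Nt; have [_ -> _ _] := hN t tI Nt.
  rewrite normrZ; apply: ler_wpM2r => //.
  apply: le_trans (pulse_norm_le _ (ltW T1) (ltW T2) k0) _.
  by rewrite ge_max !le_max lexx kab orbT.
have [iF JF] := J_sub JDx JDo; rewrite -subr_lt0 JF.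
have T1E : tau1 - tau = a * h by rewrite tau1E; clear; ring.
have T2E : tau2 - tau1 = b * h by rewrite tau2E; clear; ring.
apply: (needle_integral_lt0 al01 be0 (ltW t0tau) T1 T2 t2t1 T1E T2E h0 KL0 fN nle nint iF
  (c1 := w tau * (L1 - L0) + 2 * e') (c2 := w tau * (L2 - L0) + 2 * e')).
- move=> t tI Nt ct; have [_ _ H] := off t tI Nt ct; rewrite -DE -DxE.
  have -> : KL * ((t1 - t) `^ (be - 1) * `|needle al tau tau1 tau2 k t|) =
    (t1 - t) `^ (be - 1) * (n.+1%:R * C * (K * `|needle al tau tau1 tau2 k t|)).
    rewrite KLE; move: (n.+1%:R : R) (_ `^ _) (`|_|) => u1 u2 u3; clear; ring.
  apply: ler_wpM2l; first by rewrite powR_ge0.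
  apply: le_trans (ler_norm _) (le_trans H _).
  by apply: ler_wpM2l; [rewrite mulr_ge0|exact: xd].
- move=> t tI Nt c1 c2; have [_ _] := on1 t tI Nt c1 c2.
  by rewrite wE DxE DE; exact.
- move=> t tI Nt c1 c2; have [_ _] := on2 t tI Nt c1 c2.
  by rewrite wE DxE DE; exact.
have e'ab : e' * (a + b) = del / 8.
  by rewrite e'E invfM !mulrA divfK// gt_eqF.
have -> : a * (w tau * (L1 - L0) + 2 * e') + b * (w tau * (L2 - L0) + 2 * e') =
   - del + 2 * (e' * (a + b)) by rewrite delE; clear; ring.
by rewrite e'ab; move: KLe del0; clear; lra.
Qed.

End descent.

(** * Descent from an arbitrary continuity point, and the two necessary conditions *)

Section conclusion.
Context {R : realType} {n : nat}.
Notation E := (R * 'rV[R]_n.+1 * 'rV[R]_n.+1)%type.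

(** The defect and both memberships in the open set [V] are continuous in tau relative to [t0, t1],
    so they persist nearby. A neighbouring interior point outside the jump set is again a continuity
    point of the derivative. *)
Lemma needle_descent_at (al be t0 t1 : R) (x0 x1 xi : 'rV[R]_n.+1)
    (L : R -> 'rV[R]_n.+1 -> 'rV[R]_n.+1 -> R) (xo : R -> 'rV[R]_n.+1)
    (V : set E) (tau a b d : R) :
  t0 < t1 -> 0 < al <= 1 -> 0 < be -> admissible al t0 t1 x0 x1 xo ->
  L_Lx_continuous_near L (graph al t0 t1 xo) ->
  open V -> (forall p, V p -> {for p, continuous (fun q : E => L q.1.1 q.1.2 q.2)}) ->
  cont_points al t0 t1 xo tau -> 0 < a -> 0 < b -> 0 < d ->
  let D := caputo al t0 t1 xo in
  V (tau, xo tau, D tau + xi) -> V (tau, xo tau, D tau - (a / b) *: xi) ->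
  a * L tau (xo tau) (D tau + xi) + b * L tau (xo tau) (D tau - (a / b) *: xi)
    - (a + b) * L tau (xo tau) (D tau) < 0 ->
  exists x, [/\ admissible al t0 t1 x0 x1 x, J_defined al be t0 t1 L x,
    (norm_C t0 t1 (x \- xo)%R <= d%:E)%E,
    (norm_Linf t0 t1 (caputo al t0 t1 (x \- xo)%R) <= (Num.max 1 (a / b) * `|xi|)%:E)%E
    & J al be t0 t1 L x < J al be t0 t1 L xo].
Proof.
move=> t01 al01 be0 adm LL oV cV tauT a0 b0 d0 D Vq1 Vq2 neg.
have [pca _ _] := adm; have [cxo [psi pcpsi xoE]] := pca.
have [tauI cD] := tauT; rewrite /continuous_on_at -/D in cD.
have cX : xo s @[s --> within `[t0, t1]%classic (nbhs tau)] --> xo tau.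
  exact: (subspace_continuousP _ _).1 cxo _ tauI.
have cI : s @[s --> within `[t0, t1]%classic (nbhs tau)] --> tau by exact: cvg_within.
have [U [oU GU cU _ _]] := LL.
have Uq0 : U (tau, xo tau, D tau) by apply/GU/subset_closure; exists tau.
have ct (W : set E) (g : R -> 'rV[R]_n.+1) (v : 'rV[R]_n.+1) : open W ->
    (forall p, W p -> {for p, continuous (fun q : E => L q.1.1 q.1.2 q.2)}) ->
    W (tau, xo tau, v) -> g s @[s --> within `[t0, t1]%classic (nbhs tau)] --> v ->
    (\forall s \near within `[t0, t1]%classic (nbhs tau), W (s, xo s, g s)) /\
    L s (xo s) (g s) @[s --> within `[t0, t1]%classic (nbhs tau)] --> L tau (xo tau) v.
  move=> oW cW Wq cg.
  have cp : (s, xo s, g s) @[s --> within `[t0, t1]%classic (nbhs tau)] --> ((tau, xo tau, v) : E).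
    exact: cvg_pair (cvg_pair cI cX) cg.
  have cL : L q.1.1 q.1.2 q.2 @[q --> ((tau, xo tau, v) : E)] --> L tau (xo tau) v by exact: cW _ Wq.
  by split; [apply: cp; exact: open_nbhs_nbhs|exact: cvg_comp cp cL].
have [n1 c1] := ct V _ _ oV cV Vq1 (cvgD cD (cvg_cst xi)).
have [n2 c2] := ct V _ _ oV cV Vq2 (cvgB cD (cvg_cst ((a / b) *: xi))).
have [_ c0] := ct U _ _ oU cU Uq0 cD.
have cF : a * L s (xo s) (D s + xi) + b * L s (xo s) (D s - (a / b) *: xi)
    - (a + b) * L s (xo s) (D s) @[s --> within `[t0, t1]%classic (nbhs tau)] -->
    a * L tau (xo tau) (D tau + xi) + b * L tau (xo tau) (D tau - (a / b) *: xi)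
    - (a + b) * L tau (xo tau) (D tau).
  exact: cvgB (cvgD (cvgM (cvg_cst a) c1) (cvgM (cvg_cst b) c2)) (cvgM (cvg_cst (a + b)) c0).
have n3 : within `[t0, t1]%classic (nbhs tau) (fun s => a * L s (xo s) (D s + xi) +
    b * L s (xo s) (D s - (a / b) *: xi) - (a + b) * L s (xo s) (D s) < 0).
  exact: cvgr_lt _ cF _ neg.
have [D0 [fD0 _ _ _ hD0]] := caputo_PCa al01 t01 pcpsi xoE.
have nP : within `[t0, t1]%classic (nbhs tau)
  ((fun s => V (s, xo s, D s + xi)) `&`
   ((fun s => V (s, xo s, D s - (a / b) *: xi)) `&`
    (fun s => a * L s (xo s) (D s + xi) + b * L s (xo s) (D s - (a / b) *: xi)
      - (a + b) * L s (xo s) (D s) < 0))).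
  by apply: filterI; [exact: n1|apply: filterI; [exact: n2|exact: n3]].
have [s [sI sD hs]] := exists_near_notin_finite t01 tauI fD0 nP.
have sI' : s \in `[t0, t1].
  by move: sI; rewrite !in_itv/= => /andP[h1 h2]; rewrite (ltW h1) (ltW h2).
have [s1 [s2 s3]] := hs sI'.
exact: needle_descent al01 be0 adm LL oV cV sI (hD0 s sI' sD) a0 b0 d0 s1 s2 s3.
Qed.

End conclusion.

Theorem theorem3 (R : realType) (n : nat) (t0 t1 alpha beta : R)
    (x0 x1 : 'rV[R]_n.+1) (L : R -> 'rV[R]_n.+1 -> 'rV[R]_n.+1 -> R)
    (xo : R -> 'rV[R]_n.+1) :
  t0 < t1 -> 0 < alpha -> alpha <= 1 -> 0 < beta ->
  admissible alpha t0 t1 x0 x1 xo ->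
  L_Lx_continuous_near L (graph alpha t0 t1 xo) ->
  let D := caputo alpha t0 t1 xo in
  let T := cont_points alpha t0 t1 xo in
  let ineq (tau a b : R) (xi : 'rV[R]_n.+1) :=
    0 <= a * L tau (xo tau) (D tau + xi)
         + b * L tau (xo tau) (D tau - (a / b) *: xi)
         - (a + b) * L tau (xo tau) (D tau) in
  (L_continuous_near L (cylinder t0 t1 xo) ->
   strong_local_min alpha beta t0 t1 L x0 x1 xo ->
   forall (tau a b : R) (xi : 'rV[R]_n.+1),
     T tau -> 0 < a -> 0 < b -> ineq tau a b xi)
  /\
  (weak_local_min alpha beta t0 t1 L x0 x1 xo ->
   exists2 delta : R, 0 < delta &
     forall (tau a b : R) (xi : 'rV[R]_n.+1),
       T tau -> 0 < a -> 0 < b -> a / b < 1 -> `|xi| <= delta / 2 ->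
       ineq tau a b xi).
Proof.
move=> t01 al0 al1 be0 adm LL D T ineq.
have al01 : 0 < alpha <= 1 by rewrite al0 al1.
split.
  move=> [V [oV cylV cV]] [_ [d d0 hmin]] tau a b xi tauT a0 b0.
  rewrite /ineq leNgt; apply/negP => neg.
  have [tauI _] := tauT.
  (* [V] surrounds the whole cylinder, so the shifted points lie in it for every xi. *)
  have cyl v : V (tau, xo tau, v) by apply/cylV/subset_closure.
  have d2 : 0 < d / 2 by rewrite divr_gt0.
  have [x [admx Jx nx _ lt]] :=
    needle_descent_at t01 al01 be0 adm LL oV cV tauT a0 b0 d2 (cyl _) (cyl _) neg.
  have nd : (norm_C t0 t1 (x \- xo)%R < d%:E)%E.
    by apply: le_lt_trans nx _; rewrite lte_fin ltr_pdivrMr// ltr_pMr// ltr1n.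
  by have := hmin x admx Jx nd; rewrite leNgt lt.
move=> [_ [d d0 hmin]].
have [pca _ _] := adm.
have [r [C [U [r0 oU cU _ hU]]]] :=
  uniform_graph_neighbourhood (closure_graph_compact al01 t01 pca) LL.
(* [r] keeps both shifted points in [U], the second one because a/b < 1; [d] makes the derivative
   part of the distance at most d/2. *)
exists (Num.min d r); first by rewrite lt_min d0 r0.
move=> tau a b xi tauT a0 b0 ab xiE; rewrite /ineq leNgt; apply/negP => neg.
have [xid xir] : `|xi| <= d / 2 /\ `|xi| < r.
  split; first by apply: le_trans xiE _; rewrite ler_pM2r ?invr_gt0// ge_min lexx.
  apply: (@le_lt_trans _ _ (r / 2)); last by rewrite ltr_pdivrMr// ltr_pMr// ltr1n.
  by apply: le_trans xiE _; rewrite ler_pM2r ?invr_gt0// ge_min lexx orbT.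
have Gq : closure (graph alpha t0 t1 xo) (tau, xo tau, D tau).
  by apply: subset_closure; exists tau.
have inU (v : 'rV[R]_n.+1) : `|D tau - v| < r -> U (tau, xo tau, v).
  move=> hv; have bv : ball (tau, xo tau, D tau) r (tau, xo tau, v).
    by split; [exact: ballxx|rewrite -ball_normE].
  by have [] := hU _ _ Gq bv.
have U1 : U (tau, xo tau, D tau + xi) by apply: inU; rewrite opprD addNKr normrN.
have U2 : U (tau, xo tau, D tau - (a / b) *: xi).
  apply: inU; rewrite subKr normrZ (ger0_norm (ltW (divr_gt0 a0 b0))).
  by apply: le_lt_trans xir; rewrite ler_piMl// ltW.
(* The uniform part takes d/4 and the derivative part at most d/2, where max(1, a/b) is 1; the sum
   is below d. *)
have d4 : 0 < d / 4 by rewrite divr_gt0.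
have [x [admx Jx nx ndx lt]] :=
  needle_descent_at t01 al01 be0 adm LL oU cU tauT a0 b0 d4 U1 U2 neg.
have nd : (norm_PCa alpha t0 t1 (x \- xo)%R < d%:E)%E.
  apply: le_lt_trans (leeD nx ndx) _; rewrite -EFinD lte_fin (max_l (ltW ab)) mul1r.
  by move: xid d0; clear; lra.
by have := hmin x admx Jx nd; rewrite leNgt lt.
Qed.
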